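(* Let $X_1,X_2,\dots$ be i.i.d. with regular density $f(x\mid\boldsymbol\theta)$, let $\boldsymbol\theta=(\boldsymbol\theta_{(1)},\dots,\boldsymbol\theta_{(m)})$ be an $m$-ordered grouping with $\boldsymbol\theta_{(i)}$ of dimension $q_i$ ($i=1,\dots,m$), and let $N$ be a proper stopping time. Suppose that the Fisher information matrix corresponding to the single observation $X_1$ is block diagonal of the form $$\mathbf I(\boldsymbol\theta)=\mathrm{diag}\Big(\prod_{i=1}^m \boldsymbol G_{1i}(\boldsymbol\theta_{(i)}),\ \dots,\ \prod_{i=1}^m \boldsymbol G_{mi}(\boldsymbol\theta_{(i)})\Big),$$ where $\boldsymbol G_{li}$ is a $q_l\times q_l$ matrix-valued function of $\boldsymbol\theta_{(i)}$ only, for $l,i=1,\dots,m$. Assume further that the expected stopping time is of the form $$E_{\boldsymbol\theta}(N)=\prod_{i=1}^m g_i(\boldsymbol\theta_{(i)}),$$ where each $g_i$ is a positive function of $\boldsymbol\theta_{(i)}$ only. Then the reference prior for $\boldsymbol\theta$ (for the ordered grouping $(\boldsymbol\theta_{(1)},\dots,\boldsymbol\theta_{(m)})$) in the sequential experiment with stopping time $N$ is $$\pi_R^*(\boldsymbol\theta_{(1)},\dots,\boldsymbol\theta_{(m)})\ \propto\ \prod_{i=1}^m [g_i(\boldsymbol\theta_{(i)})]^{q_i/2}\ \pi_R(\boldsymbol\theta_{(1)},\dots,\boldsymbol\theta_{(m)}),$$ where $\pi_R$ is the reference prior (for the same ordered grouping) based on the single observation $X_1$, given (up to a positive constant factor)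 by $$\pi_R(\boldsymbol\theta_{(1)},\dots,\boldsymbol\theta_{(m)})=\prod_{i=1}^m |\boldsymbol G_{ii}(\boldsymbol\theta_{(i)})|^{1/2}.$$
   Context: Setting. $X_1,X_2,\dots$ are i.i.d. with density $f(x\mid\boldsymbol\theta)$ satisfying the usual regularity conditions. The parameter space is a product $\Theta=\Theta_1\times\cdots\times\Theta_m$ of open sets $\Theta_i\subseteq\mathbb R^{q_i}$, with $\boldsymbol\theta_{(i)}\in\Theta_i$. $\mathbf I(\boldsymbol\theta)$ is the Fisher information matrix of $X_1$; it is positive definite and continuous in $\boldsymbol\theta$. $N\ge1$ is a proper stopping time for the sequence ($P_{\boldsymbol\theta}(N<\infty)=1$ for all $\boldsymbol\theta$), and $E_{\boldsymbol\theta}(N)$ is finite and continuous in $\boldsymbol\theta$. The sequential experiment consists of observing $(X_1,\dots,X_N)$; its Fisher information matrix is $\mathbf I^*(\boldsymbol\theta)=E_{\boldsymbol\theta}(N)\,\mathbf I(\boldsymbol\theta)$ (a well-known fact). The symbol $\propto$ means equality up to a positive constant not depending on $\boldsymbol\theta$. $|A|$ denotes the absolute value of the determinant of a matrix $A$. Reference prior (Berger--Bernardo algorithm) for an ordered grouping. Let $\mathbf H(\boldsymbol\theta)$ be the Fisher information matrix of the experiment under consideration: $\mathbf H=\mathbf I$ for the experiment consisting of the single observation $X_1$, and $\mathbf H=\mathbf I^*$ for the sequential experiment. Put $\mathbf S=\mathbf H^{-1}$ and $Q_j=q_1+\cdots+q_j$. Let $\mathbf S_j$ be the upper left $Q_j\times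 Q_j$ corner of $\mathbf S$, let $\mathbf H_j=\mathbf S_j^{-1}$, and let $\mathbf h_j$ be the lower right $q_j\times q_j$ corner of $\mathbf H_j$. For each $i$ let $\Theta_i^1\subseteq\Theta_i^2\subseteq\cdots$ be compact subsets of $\Theta_i$ with non-empty interiors whose interiors have union $\Theta_i$, and set $\Theta^l=\Theta_1^l\times\cdots\times\Theta_m^l$. On $\Theta^l$ define $$\pi^l_m(\boldsymbol\theta_{(m)}\mid\boldsymbol\theta_{(1)},\dots,\boldsymbol\theta_{(m-1)})=\frac{|\mathbf h_m(\boldsymbol\theta)|^{1/2}}{\int_{\Theta_m^l}|\mathbf h_m(\boldsymbol\theta)|^{1/2}\,d\boldsymbol\theta_{(m)}},$$ and, recursively for $j=m-1,\dots,1$, $$\pi^l_j(\boldsymbol\theta_{(j)},\dots,\boldsymbol\theta_{(m)}\mid\boldsymbol\theta_{(1)},\dots,\boldsymbol\theta_{(j-1)})=\pi^l_{j+1}(\boldsymbol\theta_{(j+1)},\dots,\boldsymbol\theta_{(m)}\mid\boldsymbol\theta_{(1)},\dots,\boldsymbol\theta_{(j)})\,\frac{\exp\{\tfrac12E^l_j[\log|\mathbf h_j(\boldsymbol\theta)|]\}}{\int_{\Theta_j^l}\exp\{\tfrac12E^l_j[\log|\mathbf h_j(\boldsymbol\theta)|]\}\,d\boldsymbol\theta_{(j)}},$$ where $E^l_j[\varphi(\boldsymbol\theta)]=\int_{\Theta_{j+1}^l\times\cdots\times\Theta_m^l}\varphi(\boldsymbol\theta)\,\pi^l_{j+1}(\boldsymbol\theta_{(j+1)},\dots,\boldsymbol\theta_{(m)}\mid\boldsymbol\theta_{(1)},\dots,\boldsymbol\theta_{(j)})\,d\boldsymbol\theta_{(j+1)}\cdots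 d\boldsymbol\theta_{(m)}$. Writing $\pi^l(\boldsymbol\theta)=\pi^l_1(\boldsymbol\theta_{(1)},\dots,\boldsymbol\theta_{(m)})$ and fixing a point $\boldsymbol\theta^0\in\Theta^1$, the reference prior is $\lim_{l\to\infty}\pi^l(\boldsymbol\theta)/\pi^l(\boldsymbol\theta^0)$; it is defined up to a positive constant factor. *)

(* Defs.v *)
From HB Require Import structures.
From mathcomp Require Import all_boot all_order all_algebra.
From mathcomp Require Import all_classical all_reals all_analysis.
Set Implicit Arguments.
Unset Strict Implicit.
Unset Printing Implicit Defensive.
Import Order.TTheory GRing.Theory Num.Theory.
Import numFieldNormedType.Exports.
Local Open Scope classical_set_scope.
Local Open Scope ring_scope.

Definition tuple_cons (T : Type) (n : nat) (p : T * n.-tuple T) :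
  n.+1.-tuple T := [tuple of p.1 :: p.2].

Lemma measurable_tuple_cons d (T : measurableType d) (n : nat) :
  measurable_fun setT (@tuple_cons T n).
Proof.
apply: (@measurable_cons _ _ _ _ (@fst T (n.-tuple T)) n snd).
- exact: measurable_fst.
- exact: measurable_snd.
Qed.

(** The library instance that makes products of sigma-finite measures sigma-finite
    is shadowed by the instance for subprobabilities. *)
Lemma sigma_finite_product d1 d2 (T1 : measurableType d1)
    (T2 : measurableType d2) (R : realType)
    (m1 : {sigma_finite_measure set T1 -> \bar R})
    (m2 : {sigma_finite_measure set T2 -> \bar R}) :
  sigma_finite setT (m1 \x m2)%E.
Proof.
have /sigma_finiteP[F [TF ndF Foo]] := sigma_finiteT m1.
have /sigma_finiteP[G [TG ndG Goo]] := sigma_finiteT m2.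
exists (fun n => F n `*` G n).
  rewrite -setXTT TF TG predeqE => -[x y]; split.
    move=> [/= [n _ Fnx] [k _ Gky]]; exists (maxn n k) => //; split.
    - by move: x Fnx; exact/subsetPset/ndF/leq_maxl.
    - by move: y Gky; exact/subsetPset/ndG/leq_maxr.
  by move=> [n _ []/= ? ?]; split; exists n.
move=> k; have [? ?] := Foo k; have [? ?] := Goo k.
split; first exact: measurableX.
by rewrite product_measure1E// lte_mul_pinfty// ge0_fin_numE.
Qed.

Section lebesgue_prepend.
Context (R : realType) (n : nat).
Let T := measurableTypeR R.
Let lebesgue1 : {sigma_finite_measure set T -> \bar R} := @lebesgue_measure R.
Variable mu : {sigma_finite_measure set (n.-tuple T) -> \bar R}.

Definition lebesgue_prepend : set (n.+1.-tuple T) -> \bar R :=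
  pushforward (lebesgue1 \x mu)%E (@tuple_cons T n).

HB.instance Definition _ := Measure.copy lebesgue_prepend
  (@measure_function_pushforward__canonical__measure_function_Measure
     _ _ _ _ _ _ _ (@measurable_tuple_cons _ T n)).

Let lebesgue_prepend_sigma_finite : sigma_finite setT lebesgue_prepend.
Proof.
have [F FT mF] := sigma_finite_product lebesgue1 mu.
pose uncons (t : n.+1.-tuple T) : (T * n.-tuple T)%type :=
  (thead t, [tuple of behead t]).
have muncons : measurable_fun setT uncons.
  by apply: measurable_fun_pair; [exact: measurable_tnth |
                                  exact: measurable_behead].
have tuple_consK : cancel (@tuple_cons T n) uncons.
  by case=> x t; congr (_, _); apply/val_inj.
exists (fun k => uncons @^-1` F k) => [|k].
  by rewrite -preimage_bigcup -FT preimage_setT.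
have [mFk Fkoo] := mF k; split.
  by rewrite -[X in measurable X]setTI; exact: muncons.
rewrite /lebesgue_prepend /pushforward -comp_preimage.
by rewrite (_ : uncons \o _ = idfun) //; apply/funext => p; exact: tuple_consK.
Qed.

HB.instance Definition _ := Measure_isSigmaFinite.Build _ _ _ lebesgue_prepend
  lebesgue_prepend_sigma_finite.

End lebesgue_prepend.

(** R^n is carried by the row vectors ['rV[R]_n]; its Lebesgue measure is put on
    n-tuples, which have a measurable structure in the library. *)
Fixpoint lebesgue_tuple (R : realType) (n : nat) :
    {sigma_finite_measure set (n.-tuple (measurableTypeR R)) -> \bar R} :=
  match n with
  | 0 => @dirac _ (0.-tuple (measurableTypeR R)) [tuple] R
  | n'.+1 => lebesgue_prepend (lebesgue_tuple R n')
  end.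

Section sampling.
Context (R : realType) (p : nat).
Context (dX dW : measure_display).
Context (X : measurableType dX) (W : measurableType dW).
Implicit Types (Theta : set 'rV[R]_p) (theta : 'rV[R]_p).
Implicit Types (f : 'rV[R]_p -> X -> R) (P : 'rV[R]_p -> probability W R).
Implicit Types (Xs : nat -> W -> X) (N : W -> option nat).

Definition partial (a : 'I_p) (F : 'rV[R]_p -> R) theta : R :=
  'D_(delta_mx 0 a) F theta.

(** These are the conditions under which scores have mean zero and the Fisher
    information is finite; scores are only used where the density is positive. *)
Record regular_density Theta (nu : {sigma_finite_measure set X -> \bar R}) f :
    Prop := RegularDensity {
  density_measurable : forall theta, Theta theta -> measurable_fun setT (f theta);
  density_ge0 : forall theta, Theta theta -> forall x, 0 <= f theta x;
  density_int1 : forall theta, Theta theta ->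
    (\int[nu]_x (f theta x)%:E = 1)%E;
  density_support : forall theta theta', Theta theta -> Theta theta' ->
    forall x, 0 < f theta x -> 0 < f theta' x;
  density_derivable : forall theta, Theta theta -> forall a x,
    derivable (f ^~ x) theta (delta_mx 0 a);
  density_partial_integrable : forall theta, Theta theta -> forall a,
    nu.-integrable setT (EFin \o (fun x => partial a (f ^~ x) theta));
  density_interchange : forall theta, Theta theta -> forall a,
    partial a (fun t => \int[nu]_x f t x) theta
      = \int[nu]_x partial a (f ^~ x) theta;
  density_score_square : forall theta, Theta theta -> forall a,
    (\int[nu]_x ((partial a (fun t => ln (f t x)) theta) ^+ 2 * f theta x)%:E
       < +oo)%E }.

(** [Xs k] is the observation number [k + 1]. *)
Definition iid_with_density Theta P Xs
    (nu : {sigma_finite_measure set X -> \bar R}) f : Prop :=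
  (forall k, measurable_fun setT (Xs k)) /\
  forall theta, Theta theta ->
    (forall k A, measurable A ->
       P theta (Xs k @^-1` A) = (\int[nu]_(x in A) (f theta x)%:E)%E) /\
    (forall n (A : nat -> set X), (forall k, measurable (A k)) ->
       P theta (\bigcap_(k in `I_n) (Xs k @^-1` A k))
         = (\prod_(k < n) P theta (Xs k @^-1` A k))%E).

Definition sample_sigma_algebra Xs (n : nat) : set (set W) :=
  <<s \bigcup_(k in `I_n) preimage_set_system setT (Xs k) measurable >>.

(** Stopping times take values in the extended natural numbers; [None] stands
    for infinity. *)
Definition is_stopping_time Xs N : Prop :=
  (forall w, N w <> Some 0%N) /\
  (forall n, sample_sigma_algebra Xs n [set w | N w = Some n]).

Definition proper_stopping_time Theta P N : Prop :=
  forall theta, Theta theta -> P theta [set w | N w <> None] = 1%E.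

Definition expected_stopping_time P N theta : \bar R :=
  (\int[P theta]_w (if N w is Some n then n%:R%:E else +oo))%E.

(** Likelihood of the observed sample [(X_1, ..., X_N)]; the value 1 on the
    null event that sampling never stops is immaterial. *)
Definition sequential_likelihood f Xs N theta (w : W) : R :=
  if N w is Some n then \prod_(k < n) f theta (Xs k w) else 1.

Definition fisher_information P (L : 'rV[R]_p -> W -> R) theta : 'M[R]_p :=
  \matrix_(a, b) fine ('E_(P theta)[fun w =>
    (partial a (fun t => ln (L t w)) theta *
     partial b (fun t => ln (L t w)) theta)%R])%E.

Definition single_information P f Xs : 'rV[R]_p -> 'M[R]_p :=
  fisher_information P (fun theta w => f theta (Xs 0%N w)).

Definition sequential_information P f Xs N : 'rV[R]_p -> 'M[R]_p :=
  fisher_information P (sequential_likelihood f Xs N).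

End sampling.

Definition positive_definite (R : realType) (p : nat) (A : 'M[R]_p) : Prop :=
  A^T = A /\ forall v : 'rV[R]_p, v != 0 -> 0 < (v *m A *m v^T) 0 0.

Section corners.
Context (R : realType) (n k : nat) (kn : (k <= n)%N).

Definition upper_left (A : 'M[R]_n) : 'M[R]_k :=
  mxsub (widen_ord kn) (widen_ord kn) A.

(** [i] is sent to [n - k + i]. *)
Definition last_ord (i : 'I_k) : 'I_n := rev_ord (widen_ord kn (rev_ord i)).

Definition lower_right (A : 'M[R]_n) : 'M[R]_k := mxsub last_ord last_ord A.

End corners.

(** The point obtained from [theta] by replacing the coordinates number
    [o, ..., o + k - 1] by the entries of [x]. *)
Definition splice (R : realType) (p k o : nat)
    (x : k.-tuple (measurableTypeR R)) (theta : 'rV[R]_p) : 'rV[R]_p :=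
  \row_c (if (o <= c < o + k)%N then nth 0 (x : seq R) (c - o) else theta 0 c).

Section reference_prior.
Context (R : realType) (m : nat) (q : 'I_m -> nat).
Local Notation dim := (\sum_(i < m) q i)%N.

(** The total dimension of the first [j] groups; the group [j : 'I_m] (counted
    from 0) occupies the coordinates number
    [group_dim j, ..., group_dim j.+1 - 1], so that [group_dim j.+1] plays the
    role of Q_j for that group. *)
Definition group_dim (j : nat) : nat := (\sum_(i < m | (i < j)%N) q i)%N.

Lemma group_dim_le (j : nat) : (group_dim j <= dim)%N.
Proof. by rewrite /group_dim big_mkcond leq_sum // => i _; case: ifP. Qed.

Lemma group_size_le (j : 'I_m) : (q j <= group_dim j.+1)%N.
Proof. by rewrite /group_dim (bigD1 j) //= leq_addr. Qed.

Definition h_block (H : 'M[R]_dim) (j : 'I_m) : 'M[R]_(q j) :=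
  lower_right (group_size_le j)
    (invmx (upper_left (group_dim_le j.+1) (invmx H))).

Variables (K : forall i : 'I_m, set 'rV[R]_(q i)) (H : 'rV[R]_dim -> 'M[R]_dim).

Definition group_integral (j : 'I_m) (F : 'rV[R]_dim -> R)
    (theta : 'rV[R]_dim) : R :=
  \int[lebesgue_tuple R (q j)]_(x in
       [set x | @K j (submxrow (splice (group_dim j) x theta) j)])
    F (splice (group_dim j) x theta).

Definition tail_integral (j : 'I_m) (F : 'rV[R]_dim -> R)
    (theta : 'rV[R]_dim) : R :=
  \int[lebesgue_tuple R (dim - group_dim j.+1)]_(x in
       [set x | forall i : 'I_m, (j < i)%N ->
          @K i (submxrow (splice (group_dim j.+1) x theta) i)])
    F (splice (group_dim j.+1) x theta).

(** [conditional_prior [:: j; j + 1; ...; m - 1]] is the conditional prior of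
    the groups from [j] onwards given the groups before [j]. The formulas are
    those valid on the product of the [K i], where this function is used. *)
Fixpoint conditional_prior (js : seq 'I_m) : 'rV[R]_dim -> R :=
  match js with
  | [::] => fun=> 1
  | j :: js' =>
      let prior_after := conditional_prior js' in
      let weight theta :=
        if js' is [::] then Num.sqrt `|\det (h_block (H theta) j)|
        else expR (2^-1 * tail_integral j (fun t =>
               ln `|\det (h_block (H t) j)| * prior_after t) theta) in
      fun theta => prior_after theta * (weight theta / group_integral j weight theta)
  end.

Definition compact_prior : 'rV[R]_dim -> R := conditional_prior (enum 'I_m).

End reference_prior.

Definition product_set (R : realType) (m : nat) (q : 'I_m -> nat)
    (A : forall i : 'I_m, set 'rV[R]_(q i)) : set 'rV[R]_(\sum_(i < m) q i) :=
  [set theta | forall i, A i (submxrow theta i)].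

(** [K l] is the compact set with number [l + 1]. *)
Definition compact_exhaustion (R : realType) (n : nat) (U : set 'rV[R]_n)
    (K : nat -> set 'rV[R]_n) : Prop :=
  [/\ forall l, compact (K l) /\ K l `<=` U,
      forall l, K l `<=` K l.+1,
      forall l, (K l)° !=set0 &
      \bigcup_l (K l)° = U].

(** [prior] is the reference prior on the product of the [Theta i] for the
    information matrix [H], the ordered grouping of sizes [q], the compact sets
    [K i l] and the base point [theta0]; it is determined up to a positive
    constant factor. *)
Definition is_reference_prior (R : realType) (m : nat) (q : 'I_m -> nat)
    (Theta : forall i : 'I_m, set 'rV[R]_(q i))
    (K : forall i : 'I_m, nat -> set 'rV[R]_(q i))
    (theta0 : 'rV[R]_(\sum_(i < m) q i))
    (H : 'rV[R]_(\sum_(i < m) q i) -> 'M[R]_(\sum_(i < m) q i))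
    (prior : 'rV[R]_(\sum_(i < m) q i) -> R) : Prop :=
  exists2 c : R, 0 < c & forall theta, product_set Theta theta ->
    (fun l : nat => compact_prior (fun i => K i l) H theta /
                    compact_prior (fun i => K i l) H theta0) @ \oo
      --> c * prior theta.

(* Main.v *)
Require Import Defs.
From mathcomp Require Import all_boot all_order all_algebra.
From mathcomp Require Import all_classical all_reals all_analysis.
From mathcomp Require Import measurable_realfun.
From mathcomp Require Import ring lra zify.
Set Implicit Arguments.
Unset Strict Implicit.
Unset Printing Implicit Defensive.
Import Order.TTheory GRing.Theory Num.Theory.
Import numFieldNormedType.Exports.
Local Open Scope classical_set_scope.
Local Open Scope ring_scope.

(** The Fisher information matrix of the sequential experiment is [E(N)] times that
    of one observation (lemma [sequential_informationE]). The logarithmic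
    derivatives of the sequential likelihood are, almost surely, stopped sums of
    i.i.d. scores that have mean zero and are square integrable. The score number [k],
    counted from 0, is added on the event [k < N], which depends only on the first
    [k] observations; the increments are therefore orthogonal, and the partial sums
    have second moment [Var(s) * sum_(k < n) P(k < N)]. Fatou's lemma and
    [E(N) = sum_k P(k < N)] carry this to the stopped sum itself (Wald's second
    identity, lemma [square_stopped_score]), and polarization gives the mixed
    products.

    Multiplying a block diagonal matrix by a scalar keeps it block diagonal, and for
    a block diagonal matrix the corner [h_j] is simply the [j]-th block (lemma
    [h_block_mxdiag]): inversion acts blockwise, and so does passing to upper left
    corners. For both experiments the determinants thus separate,
    [|det h_j| = prod_i a_ji(theta_(i))], with [a_ji = |det G_ji|] for one
    observation and [a_ji = g_i ^ q_j * |det G_ji|] for the sequential experiment.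

    For separated determinants the algorithm can be evaluated on every compact box.
    Going backwards over the groups, the conditional prior of the later groups is a
    product of normalised densities proportional to [sqrt a_ii] (lemma
    [conditional_priorE]). Indeed [log |det h_j|] is a sum of functions of single
    groups. The groups after [j] are integrated out by Tonelli's theorem and
    contribute a constant, the groups before [j] contribute a factor which is fixed
    when group [j] is integrated, and both disappear in the normalisation, so that
    only [sqrt a_jj(theta_(j))] remains. The ratio to the base point is free of the
    normalising constants and does not depend on the box once the box contains the
    point: it is its own limit, and the reference prior is
    [prod_i sqrt a_ii(theta_(i))]. It is determined up to a constant (lemma
    [reference_prior_unique]), hence the theorem follows from
    [sqrt (g_i ^ q_i * |det G_ii|) = g_i ^ (q_i / 2) * sqrt |det G_ii|].

    The integrals require every single factor [a_ji] to be continuous, whereas the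
    assumptions give this for products of them; freezing all groups but one at the
    base point separates the factors (lemma [separate_continuous]). *)

(** * Block diagonal matrices and their determinants *)

Section group_indices.
Context (m : nat) (q : 'I_m -> nat).
Local Notation dim := (\sum_(i < m) q i)%N.

Lemma group_dimS (j : 'I_m) : group_dim q j.+1 = (group_dim q j + q j)%N.
Proof.
rewrite /group_dim (bigD1 j) //= addnC; congr (_ + _)%N.
by apply: eq_bigl => i; rewrite ltnS leq_eqVlt -val_eqE; case: ltngtP.
Qed.

Lemma leq_group_dim (j k : nat) : (j <= k)%N ->
  (group_dim q j <= group_dim q k)%N.
Proof.
move=> jk; rewrite /group_dim big_mkcond [leqRHS]big_mkcond leq_sum // => i _.
by case: ifP => // /leq_trans -> //.
Qed.

Lemma val_Rank (j : 'I_m) (c : 'I_(q j)) :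
  tagnat.Rank j c = (group_dim q j + c)%N :> nat.
Proof. exact: tagnat.RankEsum. Qed.

(** Translates the position of a coordinate into its group: the corner of order
    [group_dim q j.+1] consists of the groups up to [j]. *)
Lemma ltn_group_dim (s : 'I_dim) (j : 'I_m) :
  (s < group_dim q j.+1)%N = (tagnat.sig1 s <= j)%N.
Proof.
have sE := tagnat.rect s; rewrite -/(group_dim q _) in sE.
have [sj|sj] := leqP (tagnat.sig1 s) j.
- rewrite (leq_trans _ (leq_group_dim (sj : (_.+1 <= j.+1)%N)))//.
  by rewrite sE group_dimS ltn_add2l.
- apply/negbTE; rewrite -leqNgt sE.
  by rewrite (leq_trans (leq_group_dim sj))// leq_addr.
Qed.

End group_indices.

Section block_diagonal.
Context (R : comUnitRingType) (m : nat) (q : 'I_m -> nat).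
Implicit Types B C : forall l : 'I_m, 'M[R]_(q l).

Lemma mul_mxdiag B C :
  \mxdiag_l B l *m \mxdiag_l C l = \mxdiag_l (B l *m C l).
Proof.
rewrite [X in _ *m X]/mxdiag mul_mxdiag_mxblock; apply: eq_mxblock => i j.
by case: eqP => [<-|_]; rewrite ?conform_mx_id ?mulmx0.
Qed.

Lemma scale_mxdiag e B :
  e *: \mxdiag_l B l = \mxdiag_l (e *: B l).
Proof.
rewrite -mul_scalar_mx -mxdiagZ mul_mxdiag.
by apply: eq_mxdiag => l; rewrite mul_scalar_mx.
Qed.

Lemma mulmx1_invmx n (A C : 'M[R]_n) : A *m C = 1%:M -> invmx A = C.
Proof.
by move=> AC1; have [uA _] := mulmx1_unit AC1; rewrite -[LHS]mulmx1 -AC1 mulKmx.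
Qed.

Lemma invmx_mxdiag B : (forall l, B l \in unitmx) ->
  invmx (\mxdiag_l B l) = \mxdiag_l invmx (B l).
Proof.
move=> uB; apply: mulmx1_invmx; rewrite mul_mxdiag -[RHS]mxdiagZ.
by apply: eq_mxdiag => l; rewrite mulmxV.
Qed.

(** The diagonal blocks of a right inverse invert the blocks one by one. *)
Lemma unitmx_mxdiag_block B :
  \mxdiag_l B l \in unitmx -> forall l, B l \in unitmx.
Proof.
move=> uB l; have := mulmxV uB; set C := invmx _.
rewrite -[C]submxblockK mul_mxdiag_mxblock -(mxdiagZ 1) [in RHS]/mxdiag.
move=> /eq_mxblockP/(_ l l).
by rewrite eqxx conform_mx_id => /mulmx1_unit[].
Qed.

Lemma mxdiag_eq0 B (s t : 'I_(\sum_l q l)) :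
  tagnat.sig1 s != tagnat.sig1 t -> (\mxdiag_l B l) s t = 0.
Proof. by move=> st; rewrite mxE (negbTE st) mxE. Qed.

End block_diagonal.

Section corners_of_block_diagonal.
Context (R : realType).

(** Without the zeros in the upper right corner of [A] the product would also see
    the lower left corner of [B]. *)
Lemma upper_left_mul (n k : nat) (kn : (k <= n)%N) (A B : 'M[R]_n) :
    (forall i j : 'I_n, (i < k)%N -> (k <= j)%N -> A i j = 0) ->
  upper_left kn (A *m B) = upper_left kn A *m upper_left kn B.
Proof.
move=> A0; apply/matrixP => i j; rewrite !mxE.
rewrite (bigID (fun c : 'I_n => (c < k)%N))/= [X in _ + X]big1 ?addr0; last first.
  by move=> c; rewrite -leqNgt => kc; rewrite A0 ?mul0r//=.
rewrite big_ord_narrow; apply: eq_bigr => c _.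
by rewrite /upper_left !mxE.
Qed.

Context (m : nat) (q : 'I_m -> nat).
Implicit Types B : forall l : 'I_m, 'M[R]_(q l).

(** Inverses and upper left corners are taken blockwise, so that the inverse of
    the corner of [H^-1] is the corner of [H], whose last block is [B j]. *)
Lemma h_block_mxdiag B (j : 'I_m) : (forall l, B l \in unitmx) ->
  h_block (\mxdiag_l B l) j = B j.
Proof.
move=> uB; rewrite /h_block invmx_mxdiag//.
have -> : invmx (upper_left (group_dim_le q j.+1) (\mxdiag_l invmx (B l))) =
    upper_left (group_dim_le q j.+1) (\mxdiag_l B l).
  apply: mulmx1_invmx.
  rewrite -upper_left_mul; last first.
    move=> s t; rewrite ltn_group_dim [(group_dim _ _ <= _)%N]leqNgt ltn_group_dim.
    move=> sj tj; apply: mxdiag_eq0.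
    by apply: contraNneq tj => <-.
  rewrite mul_mxdiag (eq_mxdiag (B'_ := fun=> 1%:M)); last by move=> l; rewrite mulVmx.
  rewrite mxdiagZ; apply/matrixP => a b; rewrite !mxE.
  by congr (_ *+ nat_of_bool _).
apply/matrixP => a b.
have := submxblock_diag B j => /matrixP/(_ a b) <-.
rewrite [LHS]mxE [LHS]mxE [RHS]mxE.
have E (c : 'I_(q j)) : widen_ord (group_dim_le q j.+1)
    (last_ord (group_size_le q j) c) = tagnat.Rank j c.
  apply: ord_inj; rewrite val_Rank /= group_dimS.
  have := ltn_ord c; move: (ltn_ord c); lia.
by rewrite !E.
Qed.

End corners_of_block_diagonal.

Lemma det_continuous (R : realType) n : continuous (fun A : 'M[R]_n => \det A).
Proof.
move=> A; rewrite /determinant.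
apply: (continuous_big (op := +%R)) => [|s _]; first exact: add_continuous.
have cprod (t : 'I_n -> 'I_n) : continuous (fun B : 'M[R]_n => \prod_i B i (t i)).
  apply: continuous_big => [|i _]; first exact: mul_continuous.
  exact: coord_continuous.
move=> B; apply: (@continuousM _ _ (fun=> _) _ B); first exact: cst_continuous.
exact: cprod.
Qed.

Lemma det_prod (R : comNzRingType) n I (r : seq I) (A : I -> 'M[R]_n) :
  \det (\prod_(i <- r) A i) = \prod_(i <- r) \det (A i).
Proof. by apply: big_morph; [exact: det_mulmx|exact: det1]. Qed.

Lemma positive_definite_unit (R : realType) n (A : 'M[R]_n) :
  positive_definite A -> A \in unitmx.
Proof.
move=> [_ Apos]; rewrite unitmxE unitfE; apply/negP => /det0P[v v0 vA].
by have := Apos v v0; rewrite vA mul0mx mxE ltxx.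
Qed.

Section diagonal_blocks.
Context (R : realType) (m : nat) (q : 'I_m -> nat).

Lemma submxblock_continuous (j : 'I_m) :
  continuous (fun M : 'M[R]_(\sum_(i < m) q i) => submxblock M j j).
Proof.
move=> M A /nbhs_ballP[r /= r0 rA]; apply/nbhs_ballP; exists r => //= M' [_ MM'].
by apply: rA; split => // a b; rewrite !mxE; exact: MM'.
Qed.

Lemma abs_det_submxblock_continuous (j : 'I_m) :
  continuous (fun M : 'M[R]_(\sum_(i < m) q i) => `|\det (submxblock M j j)|).
Proof.
move=> M; apply: (@continuous_comp _ _ _ (fun M : 'M[R]_(\sum_(i < m) q i) =>
  submxblock M j j) (fun A : 'M[R]_(q j) => `|\det A|)).
  exact: submxblock_continuous.
apply: (@continuous_comp _ _ _ (fun A : 'M[R]_(q j) => \det A) (@Num.norm _ R)).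
  exact: det_continuous.
exact: norm_continuous.
Qed.

End diagonal_blocks.

(** * Lebesgue measure on tuples *)

Section coordinatewise_measurable.
Context (R : realType) d (T : measurableType d) (n : nat).
Variable phi : T -> 'rV[R]_n.
Hypothesis mphi : forall c, measurable_fun setT (fun t => phi t 0 c).

Lemma measurable_preimage_ball (y : 'rV[R]_n) (r : R) :
  measurable (phi @^-1` ball y r).
Proof.
have [r0|r0] := ltP 0 r; last first.
  rewrite (_ : _ @^-1` _ = set0) //; apply/seteqP; split => // t [].
  by rewrite ltNge r0.
rewrite (_ : phi @^-1` _ =
    \bigcap_(c in [set: 'I_n]) ((fun t => phi t 0 c) @^-1` ball (y 0 c) r)).
  apply: fin_bigcap_measurable => // c _.
  by rewrite -[X in measurable X]setTI; apply: mphi => //; exact: measurable_ball.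
apply/seteqP; split => [t [_ yt] c _|t yt]; first exact: yt.
by split => // i j; rewrite ord1; exact: yt.
Qed.

(** An open set is the union of the countably many cubes with rational centre and
    radius [1 / (k + 1)] that it contains; since they are countably many, it is
    enough that the coordinates are measurable. *)
Lemma measurable_preimage_open (U : set 'rV[R]_n) : open U ->
  measurable (phi @^-1` U).
Proof.
move=> oU.
pose qball (p : 'rV[rat]_n * nat) : set 'rV[R]_n :=
  ball (map_mx ratr p.1 : 'rV[R]_n) (p.2.+1%:R^-1).
rewrite (_ : U = \bigcup_p (if `[< qball p `<=` U >] then qball p else set0)).
  rewrite preimage_bigcup; apply: countable_bigcupT_measurable => [|p].
    exact: countableP.
  by case: ifP => _; [exact: measurable_preimage_ball|rewrite preimage_set0].
apply/seteqP; split => [y Uy|y [p _]]; last by case: asboolP => // pU /pU.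
have /nbhs_ballP[e /= e0 yU] : nbhs y U by exact: open_nbhs_nbhs.
have e20 : 0 < e / 2 by rewrite divr_gt0.
have [k _ /(_ k (leqnn _))/= ke] := near_infty_natSinv_lt (PosNum e20).
have k0 : 0 < k.+1%:R^-1 :> R by rewrite invr_gt0.
have cV c : exists v : rat, `|ratr v - y 0 c| < k.+1%:R^-1.
  have [v] : exists v, ratr v \in `]y 0 c - k.+1%:R^-1, y 0 c + k.+1%:R^-1[.
    by apply: rat_in_itvoo; rewrite ltrBlDr -addrA ltrDl addr_gt0.
  by rewrite in_itv /= => yv; exists v; rewrite ltr_distl.
pose v : 'rV[rat]_n := \row_c xchoose (cV c).
have vy c : `|ratr (v 0 c) - y 0 c| < k.+1%:R^-1.
  by rewrite mxE; exact: (xchooseP (cV c)).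
exists (v, k) => //; rewrite asboolT.
  by split => // i c; rewrite ord1 mxE; exact: vy.
move=> z [_ vz]; apply: yU; split => // i c; rewrite ord1.
have := vz 0 c; rewrite mxE -!ball_normE /= => vzc.
rewrite (le_lt_trans (ler_distD (ratr (v 0 c)) _ _))// (splitr e) ltrD//.
  by rewrite distrC (lt_trans (vy c)).
exact: lt_trans vzc ke.
Qed.

Lemma measurable_preimage_closed (D : set 'rV[R]_n) : closed D ->
  measurable (phi @^-1` D).
Proof.
move=> cD; rewrite -[D]setCK preimage_setC; apply: measurableC.
exact: (measurable_preimage_open (closed_openC cD)).
Qed.

Lemma measurable_fun_continuous_comp (A D : set 'rV[R]_n) (F : 'rV[R]_n -> R) :
    open A -> {in A, continuous F} -> D `<=` A ->
    measurable (phi @^-1` D) ->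
  measurable_fun (phi @^-1` D) (F \o phi).
Proof.
move=> oA; rewrite continuous_inP// => cF DA mD.
apply: (measurability _ (RGenOpens.measurableE R)) => _ [_ [a [b ->] <-]].
rewrite (_ : _ `&` _ =
    phi @^-1` D `&` phi @^-1` (A `&` F @^-1` `]a, b[%classic)).
  apply: measurableI => //; apply: measurable_preimage_open; apply: cF.
  exact: interval_open.
by apply/seteqP; split => t [Dt]; [move=> Ft; do ?split => //; exact: DA|case].
Qed.

End coordinatewise_measurable.

Section row_of_seq.
Context (R : realType).

(** Reading blocks off sequences, rather than off tuples of a given length, lets
    one expression be used for a tuple and for its tail, without casts between
    equal dimensions. *)
Definition row_at (n o : nat) (s : seq R) : 'rV[R]_n :=
  \row_(c < n) nth 0 s (o + c).

Lemma measurable_nth (k i : nat) :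
  measurable_fun setT (fun x : k.-tuple (measurableTypeR R) => nth 0 x i).
Proof.
have [ik|ki] := ltnP i k; last first.
  rewrite (_ : (fun _ => _) = cst 0) //; apply/funext => x /=.
  by rewrite nth_default// size_tuple.
rewrite (_ : (fun _ => _) = @tnth k (measurableTypeR R) ^~ (Ordinal ik)).
  exact: measurable_tnth.
by apply/funext => x; rewrite (tnth_nth 0).
Qed.

Lemma measurable_row_at (k n o : nat) (c : 'I_n) :
  measurable_fun setT
    (fun x : k.-tuple (measurableTypeR R) => row_at n o x 0 c).
Proof.
by under eq_fun do rewrite mxE; exact: measurable_nth.
Qed.

End row_of_seq.

Section lebesgue_tuple_theory.
Context (R : realType).
Local Notation T := (measurableTypeR R).
Local Open Scope ereal_scope.

Lemma integral_lebesgue_tupleS (n : nat) (F : n.+1.-tuple T -> \bar R) :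
    (forall x, 0 <= F x) -> measurable_fun setT F ->
  \int[lebesgue_tuple R n.+1]_x F x =
  \int[@lebesgue_measure R]_x \int[lebesgue_tuple R n]_t F (tuple_cons (x, t)).
Proof.
move=> F0 mF; rewrite /= /lebesgue_prepend.
have mc := @measurable_tuple_cons _ T n.
rewrite ge0_integral_pushforward//=; rewrite preimage_setT.
rewrite fubini_tonelli1//; first exact: measurableT_comp.
Qed.

Lemma measurable_fun_cat d (S : measurableType d) (a b : nat)
    (u : S -> a.-tuple T) (v : S -> b.-tuple T) :
    measurable_fun setT u -> measurable_fun setT v ->
  measurable_fun setT (fun s => cat_tuple (u s) (v s)).
Proof.
move=> /measurable_fun_tnthP mu /measurable_fun_tnthP mv.
apply/measurable_fun_tnthP => i; case: (split_ordP i) => j ->.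
- rewrite (_ : _ \o _ = @tnth a T ^~ j \o u); first exact: mu.
  by apply/funext => s; rewrite /= tnth_lshift.
- rewrite (_ : _ \o _ = @tnth b T ^~ j \o v); first exact: mv.
  by apply/funext => s; rewrite /= tnth_rshift.
Qed.

(** The integrand is a function of sequences because the tuples on both sides have
    lengths that agree only up to a proof. *)
Lemma integral_lebesgue_tuple_cat (a b : nat) (F : seq R -> \bar R) :
    (forall s, 0 <= F s) ->
    measurable_fun setT (fun x : (a + b).-tuple T => F x) ->
  \int[lebesgue_tuple R (a + b)]_x F x =
  \int[lebesgue_tuple R a]_u \int[lebesgue_tuple R b]_v F (u ++ v).
Proof.
elim: a F => [|a IH] F F0 mF.
  rewrite [RHS]/= integral_dirac//= ?diracT ?mul1e//.
  rewrite (_ : (fun _ => _) = cst (\int[lebesgue_tuple R b]_v F v)) //.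
  by apply/funext => u; rewrite (tuple0 u).
have mFcat : measurable_fun setT
    (fun p : a.+1.-tuple T * b.-tuple T => F (p.1 ++ p.2)).
  by apply: (measurableT_comp mF (@measurable_fun_cat _ _ a.+1 b fst snd _ _)).
rewrite [LHS](@integral_lebesgue_tupleS (a + b) (fun x => F x))//.
rewrite [RHS]integral_lebesgue_tupleS//; last 2 first.
- by move=> x; exact: integral_ge0.
- exact: (measurable_fun_fubini_tonelli_F _ mFcat).
apply: eq_integral => x _; rewrite (IH (fun s => F (x :: s)))//.
have mx : measurable_fun setT (fun t : (a + b).-tuple T => tuple_cons (x, t)).
  exact: (measurableT_comp (@measurable_tuple_cons _ T _) (pair1_measurable x)).
exact: (measurableT_comp mF mx).
Qed.

(** Balls of the maximum norm are cubes: this is what shows that compact sets have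
    finite measure and sets with interior points positive measure. *)
Lemma lebesgue_tuple_cube (n : nat) (c : nat -> R) (r : R) : (0 < r)%R ->
  lebesgue_tuple R n [set x | forall i, (i < n)%N -> (`|c i - nth 0 x i| < r)%R]
    = ((r *+ 2) ^+ n)%:E.
Proof.
move=> r0; elim: n c => [|n IH] c.
  rewrite /= diracE (_ : _ \in _ = true)//; apply/mem_set => i.
  by rewrite ltn0.
rewrite /= /lebesgue_prepend /pushforward.
pose B := [set x : n.-tuple T |
  forall i, (i < n)%N -> (`|c i.+1 - nth 0 x i| < r)%R].
have mB : measurable B.
  rewrite (_ : B = \bigcap_(i in [set: 'I_n])
    ((fun x : n.-tuple T => nth 0%R x i) @^-1` ball (c i.+1) r)).
    apply: fin_bigcap_measurable => // i _; rewrite -[X in measurable X]setTI.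
    by apply: measurable_nth => //; exact: measurable_ball.
  apply/seteqP; split => [x Bx i _|x Bx i ilt]; first exact: Bx.
  exact: (Bx (Ordinal ilt)).
rewrite (_ : _ @^-1` _ = ball (c 0%N) r `*` B).
  rewrite product_measure1E//; last exact: measurable_ball.
  rewrite [X in (X * _)%E](lebesgue_measure_ball (c 0%N) (ltW r0)).
  by rewrite [X in (_ * X)%E](IH (fun i => c i.+1)) -EFinM -exprS.
apply/seteqP; split => -[x t] /=.
  by move=> xt; split => [|i ilt]; [exact: (xt 0%N)|exact: (xt i.+1)].
by move=> [xB tB] [|i] ilt; [exact: xB|exact: tB].
Qed.

End lebesgue_tuple_theory.

(** * Integrals over successive groups of coordinates *)

Section group_product.
Context (R : realType) (m : nat) (q : 'I_m -> nat).
Local Notation T := (measurableTypeR R).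
Local Open Scope ereal_scope.
Variable v : forall i : 'I_m, 'rV[R]_(q i) -> \bar R.
Hypothesis v0 : forall i y, 0 <= @v i y.
Hypothesis mv : forall i k o,
  measurable_fun setT (fun x : k.-tuple T => @v i (row_at (q i) o x)).

(** The groups [js] stand in a row from the position [o] on; keeping track of the
    position makes an induction on [js] possible. *)
Fixpoint group_product (js : seq 'I_m) (o : nat) (s : seq R) : \bar R :=
  if js is i :: js' then
    @v i (row_at (q i) o s) * group_product js' (o + q i) s
  else 1.

Lemma group_product_ge0 js o s : 0 <= group_product js o s.
Proof. by elim: js o => //= i js IH o; rewrite mule_ge0. Qed.

Lemma measurable_group_product js o k :
  measurable_fun setT (fun x : k.-tuple T => group_product js o x).
Proof.
elim: js o => [|i js IH] o /=; first exact: measurable_cst.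
exact: (emeasurable_funM (@mv i k o) (IH _)).
Qed.

(** Peeling off an initial segment shifts the positions. *)
Lemma group_product_cat js o (u s : seq R) :
  group_product js (size u + o) (u ++ s) = group_product js o s.
Proof.
elim: js o => //= i js IH o; rewrite -addnA IH; congr (_ * _).
congr v; apply/rowP => c; rewrite !mxE nth_cat -addnA ltnNge leq_addr /=.
by rewrite addKn.
Qed.

(** Tonelli's theorem, one group at a time; the factors may vanish outside of a
    set, so this covers integrals over products of sets as well. *)
Lemma integral_group_product js :
  \int[lebesgue_tuple R (\sum_(i <- js) q i)]_x group_product js 0 x =
  \prod_(i <- js) \int[lebesgue_tuple R (q i)]_x @v i (row_at (q i) 0 x).
Proof.
elim: js => [|i js IH].
  by rewrite !big_nil /= integral_dirac//= ?diracT ?mul1e.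
have catE (u : (q i).-tuple T) (s : seq R) :
    group_product (i :: js) 0 (u ++ s)
    = v (row_at (q i) 0 u) * group_product js 0 s.
  rewrite /= -(group_product_cat js 0 u) size_tuple addn0; congr (v _ * _).
  by apply/rowP => c; rewrite !mxE nth_cat size_tuple ltn_ord.
rewrite big_cons [RHS]big_cons.
rewrite (@integral_lebesgue_tuple_cat _ _ _ (group_product (i :: js) 0)).
- under eq_integral => u _.
    under eq_integral => s _ do rewrite catE.
    rewrite ge0_integralZl//; last 2 first.
    + exact: measurable_group_product.
    + by move=> s _; exact: group_product_ge0.
    rewrite IH; over.
  rewrite ge0_integralZr//; first exact: (@mv i (q i) 0%N).
  by apply: prode_ge0 => l _; exact: integral_ge0.
- exact: group_product_ge0.
- exact: measurable_group_product.
Qed.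

(** When [js] lists the groups from [k] on, the running position is the difference
    of the dimensions of the preceding groups. *)
Lemma group_productE js k o s :
    [seq val i | i <- js] = iota k (size js) -> (o <= group_dim q k)%N ->
  group_product js (group_dim q k - o) s =
  \prod_(i <- js) @v i (row_at (q i) (group_dim q i - o) s).
Proof.
elim: js k => [|i js IH] k /=; first by rewrite big_nil.
move=> [ik jsk] ok; rewrite big_cons; congr (v (row_at _ _ _) * _).
  by rewrite ik.
rewrite -(IH k.+1)//; last by rewrite (leq_trans ok)// leq_group_dim.
by rewrite -ik group_dimS addnBAC// ik.
Qed.

End group_product.

Section suffix.
Context (m : nat) (q : 'I_m -> nat).

Lemma group_dim_suffix (js : seq 'I_m) k :
    [seq val i | i <- js] = iota k (size js) ->
  (group_dim q k + \sum_(i <- js) q i = group_dim q (k + size js))%N.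
Proof.
elim: js k => [|i js IH] k /=; first by rewrite big_nil !addn0.
move=> [ik jsk]; rewrite big_cons addnA -ik -group_dimS -addSnnS.
by rewrite IH ?ik.
Qed.

Lemma group_dimT : group_dim q m = (\sum_i q i)%N.
Proof. by apply: eq_bigl => i; rewrite ltn_ord. Qed.

Lemma mem_suffix (js : seq 'I_m) k :
    [seq val i | i <- js] = iota k (size js) -> (k + size js = m)%N ->
  forall i, (i \in js) = (k <= i)%N.
Proof.
move=> jsk km i; rewrite -(mem_map val_inj) jsk mem_iota km.
by rewrite ltn_ord andbT.
Qed.

End suffix.

Section splice.
Context (R : realType) (m : nat) (q : 'I_m -> nat).
Local Notation dim := (\sum_(i < m) q i)%N.
Implicit Types theta : 'rV[R]_dim.

Lemma submxrow_splice_before k (j : nat) (x : k.-tuple (measurableTypeR R))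
    theta (i : 'I_m) : (i < j)%N ->
  submxrow (splice (group_dim q j) x theta) i = submxrow theta i.
Proof.
move=> ij; apply/rowP => c; rewrite !mxE val_Rank leqNgt.
rewrite (_ : (_ < _)%N)//.
by rewrite (leq_trans _ (leq_group_dim q ij))// group_dimS ltn_add2l.
Qed.

Lemma submxrow_splice_after (j : nat) theta (i : 'I_m)
    (x : (dim - group_dim q j).-tuple (measurableTypeR R)) : (j <= i)%N ->
  submxrow (splice (group_dim q j) x theta) i
    = row_at (q i) (group_dim q i - group_dim q j) x.
Proof.
move=> /(leq_group_dim q) ji; apply/rowP => c; rewrite !mxE val_Rank.
rewrite (leq_trans ji (leq_addr _ _)) /=.
have := ltn_ord (tagnat.Rank i c); rewrite val_Rank => iclt.
by rewrite subnKC ?(leq_trans ji (leq_trans (leq_addr _ _) (ltnW iclt)))// iclt addnBAC.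
Qed.

Lemma submxrow_splice_at theta (j : 'I_m)
    (x : (q j).-tuple (measurableTypeR R)) :
  submxrow (splice (group_dim q j) x theta) j = row_at (q j) 0 x.
Proof.
apply/rowP => c; rewrite !mxE val_Rank leq_addr /= ltn_add2l ltn_ord.
by rewrite addKn.
Qed.

Lemma submxrow_splice_neq theta (i j : 'I_m)
    (x : (q j).-tuple (measurableTypeR R)) : i != j ->
  submxrow (splice (group_dim q j) x theta) i = submxrow theta i.
Proof.
move=> ij; have [/submxrow_splice_before -> //|ji] := ltnP i j.
have {ij}ji : (j < i)%N by rewrite ltn_neqAle ji eq_sym ij.
apply/rowP => c; rewrite !mxE val_Rank -group_dimS [X in _ && X]ltnNge.
by rewrite (leq_trans (leq_group_dim q ji) (leq_addr _ _)) andbF.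
Qed.

End splice.

Section bounded_measurable.
Context (R : realType) d (T : measurableType d) (D : set T).

(** On a set of finite measure this implies integrability and, unlike
    integrability, it is stable under products. *)
Definition bounded_measurable (f : T -> R) : Prop :=
  measurable_fun D f /\ exists M, forall x, D x -> `|f x| <= M.

Lemma bounded_measurable_cst c : bounded_measurable (fun=> c).
Proof. by split; [exact: measurable_cst|exists `|c|]. Qed.

Lemma bounded_measurableD f g : bounded_measurable f -> bounded_measurable g ->
  bounded_measurable (fun x => f x + g x).
Proof.
move=> [mf [M fM]] [mg [N gN]]; split; first exact: measurable_funD.
exists (M + N) => x Dx; rewrite (le_trans (ler_normD _ _))//.
by rewrite lerD ?fM ?gN.
Qed.

Lemma bounded_measurableM f g : bounded_measurable f -> bounded_measurable g ->
  bounded_measurable (fun x => f x * g x).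
Proof.
move=> [mf [M fM]] [mg [N gN]]; split; first exact: measurable_funM.
by exists (M * N) => x Dx; rewrite normrM ler_pM ?fM ?gN.
Qed.

Lemma bounded_measurable_sum I (s : seq I) (A : pred I) (f : I -> T -> R) :
    (forall i, A i -> bounded_measurable (f i)) ->
  bounded_measurable (fun x => \sum_(i <- s | A i) f i x).
Proof.
move=> bf; elim: s => [|i s IH].
  by under eq_fun do rewrite big_nil; exact: bounded_measurable_cst.
have [Ai|nAi] := boolP (A i); last first.
  by under eq_fun do rewrite big_cons (negbTE nAi).
under eq_fun do rewrite big_cons Ai.
exact: bounded_measurableD (bf i Ai) IH.
Qed.

Lemma bounded_measurable_prod (I : eqType) (s : seq I) (f : I -> T -> R) :
    {in s, forall i, bounded_measurable (f i)} ->
  bounded_measurable (fun x => \prod_(i <- s) f i x).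
Proof.
elim: s => [|i s IH] bf.
  by under eq_fun do rewrite big_nil; exact: bounded_measurable_cst.
under eq_fun do rewrite big_cons; apply: bounded_measurableM.
  by apply: bf; rewrite mem_head.
by apply: IH => j js; apply: bf; rewrite in_cons js orbT.
Qed.

Lemma bounded_measurable_integrable (mu : {measure set T -> \bar R}) f :
    measurable D -> (mu D < +oo)%E -> bounded_measurable f ->
  mu.-integrable D (EFin \o f).
Proof.
move=> mD muD [mf [M fM]]; apply: measurable_bounded_integrable => //.
exists M; split; first exact: num_real.
by move=> N MN x Dx; exact: le_trans (fM x Dx) (ltW MN).
Qed.

End bounded_measurable.

Section compact_sets.
Context (R : realType) (n : nat).
Implicit Types K A : set 'rV[R]_n.
Local Notation T := (measurableTypeR R).

Lemma measurable_row_compact K k o : compact K ->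
  measurable [set x : k.-tuple T | K (row_at n o x)].
Proof.
move=> cK; apply: (@measurable_preimage_closed _ _ _ _ (fun x : k.-tuple T => row_at n o x)).
  by move=> c; exact: measurable_row_at.
by apply: compact_closed => //; exact: norm_hausdorff.
Qed.

(** Continuous functions are bounded on compact sets; [S] may read many groups at
    once while [F] depends on a single one. *)
Lemma bounded_measurable_row (D : set 'rV[R]_n) K (F : 'rV[R]_n -> R) k o
    (S : set (k.-tuple T)) :
    open D -> {in D, continuous F} -> compact K -> K `<=` D ->
    measurable S -> (forall x, S x -> K (row_at n o x)) ->
  bounded_measurable S (fun x : k.-tuple T => F (row_at n o x)).
Proof.
move=> oD cF cK KD mS SK; split.
  apply: measurable_funS (measurable_row_compact o cK) SK _.
  apply: (@measurable_fun_continuous_comp _ _ _ _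
    (fun x : k.-tuple T => row_at n o x) _ D) => //.
    by move=> c; exact: measurable_row_at.
  exact: measurable_row_compact.
have cFK : {within K, continuous F}.
  by apply: continuous_in_subspaceT => y /set_mem Ky; apply: cF; exact/mem_set/KD.
have /compact_bounded[M [_ FM]] := continuous_compact cFK cK.
exists (M + 1) => x /SK Kx; apply: FM; first by rewrite ltrDl.
by exists (row_at n o x).
Qed.

Lemma lebesgue_tuple_compact K : compact K ->
  (lebesgue_tuple R n [set x | K (row_at n 0 x)] < +oo)%E.
Proof.
move=> cK; have [M [_ KM]] := compact_bounded cK.
pose phi (x : n.-tuple T) := row_at n 0 x; pose r := `|M| + 2.
have r0 : 0 < r by rewrite ltr_wpDl.
apply: (@le_lt_trans _ _ (lebesgue_tuple R n (phi @^-1` ball 0 r))).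
  apply: le_measure; rewrite ?inE.
  - exact: measurable_row_compact.
  - by apply: measurable_preimage_ball => c; exact: measurable_row_at.
  - move=> x /KM Kx; rewrite /preimage /= -ball_normE /= sub0r normrN.
    rewrite (@le_lt_trans _ _ (`|M| + 1))// ?ltrD2l ?ltr1n//.
    by apply: Kx; rewrite (le_lt_trans (ler_norm _))// ltrDl.
rewrite (_ : phi @^-1` _ =
    [set x : n.-tuple T | forall i, (i < n)%N -> `|0 - nth 0 x i| < r]).
  by rewrite (lebesgue_tuple_cube _ (fun=> 0)) ?ltry.
apply/seteqP; split => [x [_ xr] i ilt|x xr].
  by have := xr 0 (Ordinal ilt); rewrite -ball_normE /= !mxE.
by split => // i j; rewrite -ball_normE /= !mxE add0n; exact: xr.
Qed.

(** A set with an interior point contains a cube. *)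
Lemma lebesgue_tuple_interior_gt0 K : measurable [set x : n.-tuple T | K (row_at n 0 x)] ->
  K° !=set0 -> (0 < lebesgue_tuple R n [set x | K (row_at n 0 x)])%E.
Proof.
move=> mK [y /nbhs_ballP[r /= r0 yK]].
pose phi (x : n.-tuple T) := row_at n 0 x.
apply: (@lt_le_trans _ _ (lebesgue_tuple R n (phi @^-1` ball y r))).
(* The centre, extended by 0 to all natural numbers. *)
  pose c i := nth 0 [seq y 0 j | j : 'I_n] i.
  rewrite (_ : phi @^-1` _ =
      [set x : n.-tuple T | forall i, (i < n)%N -> `|c i - nth 0 x i| < r]).
    by rewrite lebesgue_tuple_cube// lte_fin exprn_gt0// mulrn_wgt0.
  have cE (i : 'I_n) : c i = y 0 i.
    by rewrite /c (nth_map i) ?size_enum_ord// nth_ord_enum.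
  apply/seteqP; split => [x [_ yx] i ilt|x yx].
    have := yx 0 (Ordinal ilt).
    by rewrite mxE -ball_normE /= -(cE (Ordinal ilt)).
  by split => // i j; rewrite ord1 mxE -ball_normE /= -cE; exact: yx.
apply: le_measure; rewrite ?inE//.
  by apply: measurable_preimage_ball => j; exact: measurable_row_at.
by move=> x; exact: yK.
Qed.

End compact_sets.

(** * Reference priors of information matrices with separated factors *)

Section square_roots.
Context (R : realType).

(** Brings the weights of all groups, given by an exponential except for the last
    group, to the same form. *)
Lemma expR_half_ln (x : R) : 0 < x -> expR (2^-1 * ln x) = Num.sqrt x.
Proof. by move=> x0; rewrite -powR12_sqrt ?ltW// /powR gt_eqF. Qed.

Lemma ln_prod_gt0 I (s : seq I) (F : I -> R) : (forall i, 0 < F i) ->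
  ln (\prod_(i <- s) F i) = \sum_(i <- s) ln (F i).
Proof.
move=> F0; elim: s => [|i s IH]; first by rewrite !big_nil ln1.
by rewrite !big_cons lnM ?posrE ?IH// prodr_gt0.
Qed.

End square_roots.

Section product_form.
Context (R : realType) (m : nat) (q : 'I_m -> nat).
Local Notation dim := (\sum_(i < m) q i)%N.
Local Notation T := (measurableTypeR R).
Variable Theta : forall i : 'I_m, set 'rV[R]_(q i).
Hypothesis Theta_open : forall i, open (@Theta i).
Variable H : 'rV[R]_dim -> 'M[R]_dim.
Variable a : forall j i : 'I_m, 'rV[R]_(q i) -> R.
Arguments a j {i}.
Hypothesis a_gt0 : forall j i y, @Theta i y -> 0 < a j y.
Hypothesis a_continuous : forall j i, {in @Theta i, continuous (@a j i)}.
Hypothesis det_h_block : forall theta, product_set (@Theta) theta ->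
  forall j, `|\det (h_block (H theta) j)| = \prod_i a j (submxrow theta i).

Definition sqrt_factor (i : 'I_m) (y : 'rV[R]_(q i)) : R := Num.sqrt (a i y).
Arguments sqrt_factor {i}.

Lemma sqrt_factor_gt0 i y : @Theta i y -> 0 < sqrt_factor y.
Proof. by move=> Ty; rewrite sqrtr_gt0 a_gt0. Qed.

Lemma sqrt_factor_continuous i : {in @Theta i, continuous (@sqrt_factor i)}.
Proof.
move=> y Ty; apply: (@continuous_comp _ _ _ (@a i i) (@Num.sqrt R)).
  exact: a_continuous.
exact: sqrt_continuous.
Qed.

Section one_compact_box.
Variable K : forall i : 'I_m, set 'rV[R]_(q i).
Hypothesis K_compact : forall i, compact (@K i).
Hypothesis K_Theta : forall i, @K i `<=` @Theta i.
Hypothesis K_interior : forall i, (@K i)° !=set0.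

Definition mass (i : 'I_m) : R :=
  \int[lebesgue_tuple R (q i)]_(x in [set x | K (row_at (q i) 0 x)])
    sqrt_factor (row_at (q i) 0 x).

Lemma integrable_sqrt_factor i : (lebesgue_tuple R (q i)).-integrable
  [set x | K (row_at (q i) 0 x)] (EFin \o fun x => sqrt_factor (row_at (q i) 0 x)).
Proof.
have mK := @measurable_row_compact R (q i) (@K i) (q i) 0 (@K_compact i).
apply: bounded_measurable_integrable => //.
  exact: lebesgue_tuple_compact.
exact: (bounded_measurable_row (@Theta_open i) (@sqrt_factor_continuous i) _ (@K_Theta i)).
Qed.

Lemma EFin_mass i : (mass i)%:E =
  (\int[lebesgue_tuple R (q i)]_(x in [set x | K (row_at (q i) 0 x)])
    (sqrt_factor (row_at (q i) 0 x))%:E)%E.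
Proof.
rewrite /mass /Rintegral fineK//.
apply: integrable_fin_num; last exact: integrable_sqrt_factor.
exact: measurable_row_compact.
Qed.

(** A continuous positive function has a positive minimum on a compact set, and the
    set has positive measure because of its interior points. *)
Lemma mass_gt0 i : 0 < mass i.
Proof.
have mK := @measurable_row_compact R (q i) (@K i) (q i) 0 (@K_compact i).
have [y Ky] : (@K i) !=set0.
  by have [y /interior_subset Ky] := @K_interior i; exists y.
have cFK : {within @K i, continuous (@sqrt_factor i)}.
  apply: continuous_in_subspaceT => z /set_mem Kz.
  by apply: sqrt_factor_continuous; apply/mem_set/K_Theta.
have [z /set_mem Kz minz] := EVT_min_rV (ex_intro _ y Ky) (@K_compact i) cFK.
rewrite -lte_fin EFin_mass.
apply: (@lt_le_trans _ _ ((sqrt_factor z)%:E *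
    lebesgue_tuple R (q i) [set x | K (row_at (q i) 0 x)])%E).
  rewrite mule_gt0 ?lte_fin ?sqrt_factor_gt0//; first exact: K_Theta.
  exact: lebesgue_tuple_interior_gt0.
rewrite -integral_cst//; apply: ge0_le_integral => //.
- by move=> x _; rewrite lee_fin ltW// sqrt_factor_gt0//; exact: K_Theta.
- by have /integrableP[] := integrable_sqrt_factor i.
- by move=> x Kx; rewrite lee_fin; apply: minz; exact/mem_set.
Qed.

(** The factor [c] and the groups before [i] do not change when the group [i] is
    integrated out, and cancel. *)
Lemma weight_ratio (i : 'I_m) (weight : 'rV[R]_dim -> R) (c : R) :
    c != 0 ->
    (forall theta, product_set (@K) theta -> weight theta =
       c * \prod_(l < m | (l < i)%N) Num.sqrt (a i (submxrow theta l)) *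
       sqrt_factor (submxrow theta i)) ->
  forall theta, product_set (@K) theta ->
    weight theta / group_integral (@K) i weight theta =
    sqrt_factor (submxrow theta i) / mass i.
Proof.
move=> c0 weightE theta Ktheta.
(* Everything in the weight that does not depend on the group [i]. *)
set b := c * \prod_(l < m | (l < i)%N) Num.sqrt (a i (submxrow theta l)).
have b0 : b != 0.
  rewrite mulf_neq0// gt_eqF// prodr_gt0// => l _.
  by rewrite sqrtr_gt0 a_gt0//; apply: K_Theta; exact: Ktheta.
have groupE : group_integral (@K) i weight theta = b * mass i.
  rewrite /group_integral -RintegralZl//; last 2 first.
  - exact: measurable_row_compact.
  - exact: integrable_sqrt_factor.
  rewrite (_ : [set x | _] = [set x : (q i).-tuple T | K (row_at (q i) 0 x)]); last first.
    by apply/funext => x; rewrite /= submxrow_splice_at.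
  apply: eq_Rintegral => x /set_mem Kx; rewrite weightE.
    rewrite submxrow_splice_at; congr (_ * _ * _); apply: eq_bigr => l li.
    by rewrite submxrow_splice_before.
  move=> l; have [->|li] := eqVneq l i; first by rewrite submxrow_splice_at.
  by rewrite submxrow_splice_neq//; exact: Ktheta.
by rewrite groupE weightE// -/b -mulf_div divff// mul1r.
Qed.

Definition density (i : 'I_m) (y : 'rV[R]_(q i)) : R := sqrt_factor y / mass i.
Arguments density {i}.

Lemma density_gt0 i y : @K i y -> 0 < density y.
Proof.
by move=> Ky; rewrite divr_gt0 ?mass_gt0// sqrt_factor_gt0//; exact: K_Theta.
Qed.

Lemma integral_density i :
  (\int[lebesgue_tuple R (q i)]_(x in [set x | K (row_at (q i) 0 x)])
    (density (row_at (q i) 0 x))%:E = 1)%E.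
Proof.
under eq_integral do rewrite /density mulrC EFinM.
rewrite integralZl//; last 2 first.
- exact: measurable_row_compact.
- exact: integrable_sqrt_factor.
by rewrite -EFin_mass -EFinM mulVf// gt_eqF// mass_gt0.
Qed.

Section tail.
Variables (j : nat) (js : seq 'I_m).
Hypothesis jsE : [seq val i | i <- js] = iota j (size js).
Hypothesis jm : (j + size js)%N = m.

Local Notation tail_dim := (dim - group_dim q j)%N.
Local Notation tail_row i x := (row_at (q i) (group_dim q i - group_dim q j) x).

Definition tail_box : set (tail_dim.-tuple T) :=
  [set x | forall i : 'I_m, (j <= i)%N -> K (tail_row i x)].

(** Stated for sequences so as to serve as the integrand of a tuple of any length. *)
Definition tail_density (x : seq R) : R := \prod_(i <- js) density (tail_row i x).

Let mem_js i : (i \in js) = (j <= i)%N := mem_suffix jsE jm i.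

Lemma measurable_tail_box : measurable tail_box.
Proof.
rewrite (_ : tail_box = \bigcap_(i in [set i : 'I_m | (j <= i)%N])
    [set x : tail_dim.-tuple T | K (tail_row i x)]).
  by apply: fin_bigcap_measurable => // i _; exact: measurable_row_compact.
by apply/seteqP; split.
Qed.

(** Extending each factor by zero outside of its compact set turns the integral over
    the box into an integral over the whole space. *)
Lemma integral_tail_prod (u : forall i : 'I_m, 'rV[R]_(q i) -> R) :
    (forall i y, @K i y -> 0 <= u i y) ->
    (forall i, {in @Theta i, continuous (u i)}) ->
  (\int[lebesgue_tuple R tail_dim]_(x in tail_box)
     (\prod_(i <- js) u i (tail_row i x))%:E =
   \prod_(i <- js) \int[lebesgue_tuple R (q i)]_(x in
     [set x | K (row_at (q i) 0 x)]) (u i (row_at (q i) 0 x))%:E)%E.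
Proof.
move=> u0 cu; rewrite integral_mkcond.
have -> : (fun x : tail_dim.-tuple T =>
      (\prod_(i <- js) u i (tail_row i x))%:E) \_ tail_box =
    (fun x : tail_dim.-tuple T =>
      group_product (fun i y => (((u i) \_ (@K i)) y)%:E) js 0 x).
  apply/funext => x; rewrite -[X in group_product _ _ X](subnn (group_dim q j)).
  rewrite group_productE// patchE; case: ifPn => [/set_mem xK|xK].
    rewrite -prodEFin; apply: eq_big_seq => i; rewrite mem_js => ji.
    by rewrite patchE mem_set//; exact: xK.
  have [i ji xKi] : exists2 i : 'I_m, (j <= i)%N & ~ K (tail_row i x).
    apply: contrapT => noi; move/negP: xK; apply; apply/mem_set => i ji.
    by apply: contrapT => xKi; apply: noi; exists i.
  apply/esym/eqP; rewrite prodEFin eqe prodf_seq_eq0; apply/hasP; exists i.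
    by rewrite mem_js.
  by rewrite /= patchE memNset.
have -> : tail_dim = (\sum_(i <- js) q i)%N.
  by have := group_dim_suffix q jsE; rewrite jm group_dimT => <-; rewrite addKn.
rewrite integral_group_product.
- apply: eq_bigr => i _.
  rewrite [RHS]integral_mkcond; apply: eq_integral => x _.
  rewrite !patchE.
  have -> : (x \in [set x : (q i).-tuple T | K (row_at (q i) 0 x)])
      = (row_at (q i) 0 x \in @K i).
    by apply/idP/idP => /set_mem ?; exact/mem_set.
  by case: ifP.
- move=> i y; rewrite patchE; case: ifPn => // /set_mem Ky.
  by rewrite lee_fin u0.
- move=> i k o; apply/measurable_EFinP.
  pose S := [set x : k.-tuple T | K (row_at (q i) o x)].
  have mS : measurable S by exact: measurable_row_compact.
  rewrite (_ : (fun _ => _) = (fun x : k.-tuple T => u i (row_at (q i) o x)) \_ S).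
    apply: (measurable_restrictT _ mS).1.
    by have [] := bounded_measurable_row (o := o) (@Theta_open i)
      (cu i) (@K_compact i) (@K_Theta i) mS (fun x Sx => Sx).
  by [].
Qed.

(** This is what makes the conditional prior a probability density, so that the
    expectation of a constant is that constant. *)
Lemma integral_tail_density :
  (\int[lebesgue_tuple R tail_dim]_(x in tail_box) (tail_density x)%:E = 1)%E.
Proof.
rewrite integral_tail_prod.
- by rewrite big1// => i _; exact: integral_density.
- by move=> i y Ky; rewrite ltW// density_gt0.
- move=> i y Ty; apply: (@continuousM _ _ (@sqrt_factor i) (fun=> (mass i)^-1)).
    exact: sqrt_factor_continuous.
  exact: cst_continuous.
Qed.

(** The measure of the box is the product integral with all factors equal to 1. *)
Lemma tail_box_finite : (lebesgue_tuple R tail_dim tail_box < +oo)%E.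
Proof.
have mT := measurable_tail_box.
have := @integral_tail_prod (fun=> fun=> 1) (fun _ _ _ => ler01)
  (fun i y _ => @cst_continuous _ _ (1 : R) y).
under eq_integral do rewrite big1//.
rewrite integral_cst// mul1e => ->; rewrite ltey_eq; apply/orP; left.
elim/big_rec : _ => // i z _ zfin; rewrite fin_numM// integral_cst ?mul1e//; last first.
  exact: measurable_row_compact.
by rewrite ge0_fin_numE// lebesgue_tuple_compact.
Qed.

Lemma bounded_measurable_tail_row (i : 'I_m) (F : 'rV[R]_(q i) -> R) :
    (j <= i)%N -> {in @Theta i, continuous F} ->
  bounded_measurable tail_box (fun x => F (tail_row i x)).
Proof.
move=> ji cF.
apply: (bounded_measurable_row (@Theta_open i) cF (@K_compact i) (@K_Theta i)).
  exact: measurable_tail_box.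
by move=> x; exact.
Qed.

Lemma bounded_measurable_tail_density :
  bounded_measurable tail_box (fun x => tail_density x).
Proof.
apply: bounded_measurable_prod => i; rewrite mem_js => ji.
apply: bounded_measurableM.
  by apply: bounded_measurable_tail_row => //; exact: sqrt_factor_continuous.
exact: bounded_measurable_cst.
Qed.

End tail.

Lemma splice_tail (j : 'I_m) theta (x : (dim - group_dim q j.+1).-tuple T) :
    product_set (@K) theta -> @tail_box j.+1 x ->
  product_set (@K) (splice (group_dim q j.+1) x theta).
Proof.
move=> Ktheta xK i; have [ij|ji] := leqP i.+1 j.+1.
  by rewrite submxrow_splice_before//; exact: Ktheta.
by rewrite submxrow_splice_after//; exact: xK.
Qed.

(** The logarithm of the determinant splits into a part depending on the groups up
    to [j], which the integration leaves alone, and a part depending on the later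
    groups, whose expectation no longer depends on the point. *)
Lemma tail_integralE (j : 'I_m) (js : seq 'I_m) (prior_after : 'rV[R]_dim -> R) :
    [seq val i | i <- js] = iota j.+1 (size js) -> (j.+1 + size js)%N = m ->
    (forall theta, product_set (@K) theta ->
       prior_after theta = \prod_(i <- js) density (submxrow theta i)) ->
  exists c, forall theta, product_set (@K) theta ->
    tail_integral (@K) j (fun t => ln `|\det (h_block (H t) j)| * prior_after t) theta
    = \sum_(i < m | (i <= j)%N) ln (a j (submxrow theta i)) + c.
Proof.
move=> jsE jm prior_afterE; pose o := group_dim q j.+1.
(* The contribution of the later groups. *)
pose B (x : (dim - o).-tuple T) :=
  \sum_(i < m | (j < i)%N) ln (a j (row_at (q i) (group_dim q i - o) x)).
exists (\int[lebesgue_tuple R (dim - o)]_(x in @tail_box j.+1)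
  (B x * tail_density j.+1 js x)) => theta Ktheta.
set A := \sum_(i < m | (i <= j)%N) ln _.
have mT := @measurable_tail_box j.+1.
have finT := tail_box_finite jsE jm.
have bp := bounded_measurable_tail_density jsE jm.
have ip : (lebesgue_tuple R (dim - o)).-integrable (@tail_box j.+1)
    (EFin \o fun x : (dim - o).-tuple T => tail_density j.+1 js x).
  exact: bounded_measurable_integrable.
have bB : bounded_measurable (@tail_box j.+1) B.
  apply: bounded_measurable_sum => i ji.
  apply: (@bounded_measurable_tail_row _ i (fun y => ln (a j y))) => //.
  move=> y Ty; apply: (@continuous_comp _ _ _ (@a j i) (@ln R)).
    exact: a_continuous.
  by apply: continuous_ln; apply: a_gt0; exact: set_mem.
transitivity (\int[lebesgue_tuple R (dim - o)]_(x in @tail_box j.+1)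
    (A * tail_density j.+1 js x + B x * tail_density j.+1 js x)).
  rewrite /tail_integral -/o.
  rewrite (_ : [set x | _] = @tail_box j.+1); last first.
    apply/seteqP; split => x xK i ji; have := xK i ji;
      by rewrite /= submxrow_splice_after.
  apply: eq_Rintegral => x /set_mem xK; rewrite -mulrDl.
  have Kx := splice_tail Ktheta xK.
  rewrite prior_afterE// det_h_block; last by move=> i; apply: K_Theta; exact: Kx.
  congr (_ * _); last first.
    apply: eq_big_seq => i; rewrite (mem_suffix jsE jm) => ji.
    by rewrite submxrow_splice_after.
  rewrite ln_prod_gt0; last by move=> i; apply: a_gt0; apply: K_Theta; exact: Kx.
  rewrite (bigID (fun i : 'I_m => (i <= j)%N))/=; congr (_ + _).
    by apply: eq_bigr => i ij; rewrite submxrow_splice_before.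
  by apply: eq_big => i; rewrite -ltnNge// => ji; rewrite submxrow_splice_after.
rewrite RintegralD//; last 2 first.
- apply: bounded_measurable_integrable => //.
  by apply: bounded_measurableM => //; exact: bounded_measurable_cst.
- by apply: bounded_measurable_integrable => //; exact: bounded_measurableM.
rewrite RintegralZl//; congr (_ + _).
by rewrite /Rintegral integral_tail_density// mulr1.
Qed.

(** Backward induction on the groups. The last group has its own clause in the
    algorithm, without an expectation; there the constant is 1. *)
Lemma conditional_priorE (js : seq 'I_m) (j : nat) :
    [seq val i | i <- js] = iota j (size js) -> (j + size js)%N = m ->
  forall theta, product_set (@K) theta ->
  conditional_prior (@K) H js theta = \prod_(i <- js) density (submxrow theta i).
Proof.
elim: js j => [|i js IH] j; first by move=> _ _ theta _; rewrite big_nil.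
move=> [ij jsE] /=; rewrite -addSnnS -ij => jm theta Ktheta.
rewrite -{j}ij in jsE.
have {}IH := IH i.+1 jsE jm.
set weight := (X in group_integral _ _ X _).
rewrite -[X in X / _]/(weight theta).
rewrite big_cons IH// mulrC; congr (_ * _).
suff [c c0 weightE] : exists2 c, c != 0 & forall theta, product_set (@K) theta ->
    weight theta = c * \prod_(l < m | (l < i)%N) Num.sqrt (a i (submxrow theta l)) *
      sqrt_factor (submxrow theta i).
  exact: (weight_ratio c0 weightE).
have sumE t : product_set (@K) t ->
    expR (2^-1 * \sum_(l < m | (l <= i)%N) ln (a i (submxrow t l))) =
    \prod_(l < m | (l < i)%N) Num.sqrt (a i (submxrow t l)) * sqrt_factor (submxrow t i).
  move=> Kt; rewrite mulr_sumr expR_sum (bigD1 i)//= mulrC; congr (_ * _).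
    apply: eq_big => l; first by rewrite ltn_neqAle andbC.
    by move=> _; rewrite expR_half_ln// a_gt0//; apply: K_Theta; exact: Kt.
  by rewrite expR_half_ln// a_gt0//; apply: K_Theta; exact: Kt.
rewrite {}/weight; case: js => [|i' js] in jsE jm IH *; last first.
  have [c cE] := tail_integralE jsE jm IH.
  exists (expR (2^-1 * c)) => [|t Kt]; first by rewrite gt_eqF// expR_gt0.
  by rewrite cE// mulrDr expRD sumE// mulrC mulrA.
exists 1 => [|t Kt]; first exact: oner_neq0.
rewrite mul1r -sumE// det_h_block; last by move=> l; apply: K_Theta; exact: Kt.
rewrite -expR_half_ln; last first.
  by apply: prodr_gt0 => l _; apply: a_gt0; apply: K_Theta; exact: Kt.
rewrite ln_prod_gt0; last by move=> l; apply: a_gt0; apply: K_Theta; exact: Kt.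
congr (expR (_ * _)); apply: eq_bigl => l; apply/esym.
by move: (ltn_ord l) jm => /=; lia.
Qed.

Lemma compact_priorE theta : product_set (@K) theta ->
  compact_prior (@K) H theta = \prod_i density (submxrow theta i).
Proof.
have enumE : size (enum 'I_m) = m by rewrite size_enum_ord.
move=> Ktheta; rewrite /compact_prior (@conditional_priorE _ 0) ?big_enum//.
by rewrite enumE val_enum_ord.
Qed.

End one_compact_box.
Variables (K : forall i : 'I_m, nat -> set 'rV[R]_(q i)) (theta0 : 'rV[R]_dim).
Hypothesis K_exhaustion : forall i, compact_exhaustion (@Theta i) (@K i).
Hypothesis theta0_in : product_set (fun i => @K i 0%N) theta0.

Lemma exhaustion_monotone i (l n : nat) : (l <= n)%N -> @K i l `<=` @K i n.
Proof.
have [_ Kmono _ _] := (@K_exhaustion i).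
by move=> /subnK <-; elim: (n - l)%N => // d IH; rewrite addSn => y /IH; exact: Kmono.
Qed.

Lemma near_compact_box theta : product_set (@Theta) theta ->
  \forall l \near \oo, product_set (fun i => @K i l) theta.
Proof.
move=> Ttheta; apply: filter_forall => i.
have [_ _ _ KU] := (@K_exhaustion i); have := Ttheta i; rewrite -KU => -[l _ Kl].
exists l => // n /= ln; apply: exhaustion_monotone ln _ _; exact: interior_subset.
Qed.

(** The normalising masses depend on the box but not on the point and cancel in the
    ratio, which is therefore constant from the first box containing the point on. *)
Lemma compact_prior_ratio_cvg theta : product_set (@Theta) theta ->
  (fun l : nat => compact_prior (fun i => @K i l) H theta /
                  compact_prior (fun i => @K i l) H theta0) @ \oo -->
  \prod_i sqrt_factor (submxrow theta i) / \prod_i sqrt_factor (submxrow theta0 i).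
Proof.
move=> Ttheta; apply: cvg_near_cst.
apply: filterS (near_compact_box Ttheta) => l Kl.
have Kcompact i : compact (@K i l) by have [/(_ l)[]] := (@K_exhaustion i).
have KT i : @K i l `<=` @Theta i by have [/(_ l)[]] := (@K_exhaustion i).
have Kint i : (@K i l)° !=set0 by have [] := (@K_exhaustion i).
have theta0l : product_set (fun i => @K i l) theta0.
  by move=> i; exact: exhaustion_monotone (theta0_in i).
rewrite !(@compact_priorE (fun i => @K i l))// /density !big_split /=.
rewrite -mulf_div divff ?mulr1//.
by rewrite gt_eqF// prodr_gt0// => i _; rewrite invr_gt0 mass_gt0.
Qed.

Lemma prod_sqrt_factor_gt0 theta : product_set (@Theta) theta ->
  0 < \prod_i sqrt_factor (submxrow theta i).
Proof. by move=> Tt; apply: prodr_gt0 => i _; exact: sqrt_factor_gt0. Qed.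

Lemma base_point_in : product_set (@Theta) theta0.
Proof.
by move=> i; have [/(_ 0%N)[_ KT] _ _ _] := (@K_exhaustion i); apply: KT; exact: theta0_in.
Qed.

Lemma is_reference_prior_sqrt_factor :
  is_reference_prior (@Theta) (@K) theta0 H
    (fun theta => \prod_i sqrt_factor (submxrow theta i)).
Proof.
exists (\prod_i sqrt_factor (submxrow theta0 i))^-1.
  by rewrite invr_gt0 prod_sqrt_factor_gt0//; exact: base_point_in.
by move=> theta Tt; rewrite mulrC; exact: compact_prior_ratio_cvg.
Qed.

(** Both functions are limits of the same ratios. *)
Lemma reference_prior_unique prior :
    is_reference_prior (@Theta) (@K) theta0 H prior ->
  exists2 c, 0 < c & forall theta, product_set (@Theta) theta ->
    prior theta = c * \prod_i sqrt_factor (submxrow theta i).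
Proof.
move=> [c c0 priorE]; have f0 := prod_sqrt_factor_gt0 base_point_in.
exists (c^-1 / \prod_i sqrt_factor (submxrow theta0 i)).
  by rewrite divr_gt0// invr_gt0.
move=> theta Tt; apply: (mulfI (lt0r_neq0 c0)).
have -> := cvg_unique _ (priorE theta Tt) (compact_prior_ratio_cvg Tt).
  by rewrite !mulrA divff ?gt_eqF// mul1r mulrC.
exact: norm_hausdorff.
Qed.

End product_form.

(** * Observations independent of the past *)

Section independence_from_the_past.
Context (R : realType) (dX dW : measure_display).
Context (X : measurableType dX) (W : measurableType dW).
Variables (P : probability W R) (Xs : nat -> W -> X).
Hypothesis mXs : forall k, measurable_fun setT (Xs k).
Hypothesis Xs_independent : forall n (A : nat -> set X),
  (forall k, measurable (A k)) ->
  P (\bigcap_(k in `I_n) (Xs k @^-1` A k)) = (\prod_(k < n) P (Xs k @^-1` A k))%E.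

Definition past (n : nat) : set (set W) :=
  \bigcup_(k in `I_n) preimage_set_system setT (Xs k) measurable.

(** Equipping the sample space with the smaller sigma-algebra makes the closure
    properties of measurable functions available for adapted variables. *)
Definition adapted d (T : measurableType d) n (Z : W -> T) : Prop :=
  @measurable_fun _ _ (g_sigma_algebraType (past n)) T setT Z.

Let measurable_preimage k B : measurable B -> measurable (Xs k @^-1` B).
Proof. by move=> mB; rewrite -[X in measurable X]setTI; exact: mXs. Qed.

Lemma sample_sigma_algebra_measurable n A :
  sample_sigma_algebra Xs n A -> measurable A.
Proof.
apply: smallest_sub => [|B [k _ [C mC <-]]]; first exact: sigma_algebra_measurable.
by rewrite setTI; exact: measurable_preimage.
Qed.

Lemma adapted_measurable d (T : measurableType d) n (Z : W -> T) :
  adapted n Z -> measurable_fun setT Z.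
Proof.
move=> mZ _ B mB; apply: (@sample_sigma_algebra_measurable n).
exact: (mZ measurableT B mB).
Qed.

Lemma sample_sigma_algebra_le n k : (n <= k)%N ->
  sample_sigma_algebra Xs n `<=` sample_sigma_algebra Xs k.
Proof.
move=> nk; apply: sub_sigma_algebra2 => B [i /= ilt iB].
by exists i => //=; exact: leq_trans ilt nk.
Qed.

Lemma adapted_le d (T : measurableType d) n k (Z : W -> T) : (n <= k)%N ->
  adapted n Z -> adapted k Z.
Proof.
by move=> nk mZ mT B mB; apply: (sample_sigma_algebra_le nk); exact: mZ.
Qed.

Lemma adapted_obs n k : (k < n)%N -> adapted n (Xs k).
Proof.
by move=> kn _ B mB; apply: sub_sigma_algebra; exists k => //; exists B.
Qed.

(** Independence is given for finite intersections of events about single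
    observations. These form a pi-system that generates the past, and the events
    satisfying the product rule form a lambda-system. *)
Lemma independent_of_past n A B : sample_sigma_algebra Xs n A -> measurable B ->
  P (A `&` Xs n @^-1` B) = (P A * P (Xs n @^-1` B))%E.
Proof.
move=> nA mB; have mE := measurable_preimage n mB; set E := Xs n @^-1` B in mE *.
pose C := [set \bigcap_(k in `I_n) (Xs k @^-1` A k) | A in
  [set A : nat -> set X | forall k, measurable (A k)]].
pose Hs := [set S | measurable S /\ P (S `&` E) = (P S * P E)%E].
(* The past is generated by events about one observation, which are intersections
   with trivial conditions on the others. *)
suff CH : <<s C >> `<=` Hs.
  suff /CH[] : <<s C >> A by [].
  move: A nA; apply: smallest_sub; first exact: smallest_sigma_algebra.
  move=> _ [k /= kn [D mD <-]]; rewrite setTI; apply: sub_sigma_algebra.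
  exists (fun i => if i == k then D else setT).
    by move=> i /=; case: ifP.
  apply/seteqP; split => w /= wD; first by have := wD k kn; rewrite eqxx.
  by move=> i _; case: eqP => [->|].
apply: lambda_system_subset => //.
- move=> _ _ [A1 mA1 <-] [A2 mA2 <-]; exists (fun k => A1 k `&` A2 k).
    by move=> k; exact: measurableI.
  by rewrite -bigcapI; apply: eq_bigcapr => k _; rewrite preimage_setI.
- apply/dynkin_lambda_system; split.
  + by split; [exact: measurableT|rewrite setTI probability_setT mul1e].
  + move=> S [mS SE]; split; first exact: measurableC.
    rewrite setIC -setDE measureD//; last by rewrite ltey_eq fin_num_measure.
    rewrite [X in (_ - X)%E](_ : _ = (P S * P E)%E); last by rewrite setIC.
    rewrite probability_setC// muleBl ?mul1e ?fin_num_measure//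
      fin_num_adde_defr ?fin_num_measure.
  + move=> S tS HS.
    have mS k : measurable (S k) by have [] := HS k.
    split; first exact: bigcup_measurable.
    rewrite setI_bigcupl measure_bigcup//; last 2 first.
    * by move=> k _; exact: measurableI.
    * exact: trivIset_setIr.
    have PE : P E = (fine (P E))%:E by rewrite fineK// fin_num_measure.
    rewrite [LHS](_ : _ = \sum_(0 <= k <oo | k \in [set: nat])
      ((fine (P E))%:E * P (S k)))%E; last first.
      by apply: eq_eseriesr => k _; rewrite -PE muleC; have [] := HS k.
    by rewrite nneseriesZl// -PE muleC measure_bigcup.
- move=> _ [A' mA' <-]; split.
    by apply: fin_bigcap_measurable => // k _; exact: measurable_preimage.
  (* The event about observation [n] becomes one more factor of the intersection. *)
  pose A'' k := if (k < n)%N then A' k else B.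
  have mA'' k : measurable (A'' k) by rewrite /A''; case: ifP.
  have -> : \bigcap_(k in `I_n) (Xs k @^-1` A' k) =
            \bigcap_(k in `I_n) (Xs k @^-1` A'' k).
    by apply: eq_bigcapr => k /= kn; rewrite /A'' kn.
  rewrite (_ : _ `&` E = \bigcap_(k in `I_n.+1) (Xs k @^-1` A'' k)).
    rewrite !Xs_independent// big_ord_recr /=; congr (_ * P _)%E.
    by rewrite /E /A'' ltnn.
  apply/seteqP; split => w.
    move=> [wA wE] k /=; rewrite ltnS leq_eqVlt => /predU1P[->|kn]; last exact: wA.
    by rewrite /A'' ltnn.
  move=> wA; split => [k kn|]; first by apply: wA; exact: ltnW.
  by have := wA n (ltnSn n); rewrite /A'' /= ltnn.
Qed.

Section product_law.
Variables (n : nat) (Z : W -> R).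
Hypothesis Zn : adapted n Z.

Let mZ : measurable_fun setT Z := adapted_measurable Zn.
Let Zm : {mfun W >-> R} := mfun_Sub (mem_set mZ).
Let Xm : {mfun W >-> X} := mfun_Sub (mem_set (mXs n)).
Let ZXm : {mfun W >-> (R * X)%type} :=
  mfun_Sub (mem_set (measurable_fun_pair mZ (mXs n))).

(** Independence as an equality of laws, which makes Fubini's theorem available. *)
Lemma product_law A : measurable A ->
  (distribution P Zm \x distribution P Xm)%E A = distribution P ZXm A.
Proof.
apply: product_measure_unique => B C mB mC.
rewrite /distribution /pushforward /= -independent_of_past//.
have := Zn measurableT mB; rewrite setTI; exact.
Qed.

Lemma ge0_integral_product_law (h : R * X -> \bar R) :
    measurable_fun setT h -> (forall p, 0 <= h p)%E ->
  (\int[P]_w h (Z w, Xs n w) =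
   \int[distribution P Zm]_z \int[distribution P Xm]_x h (z, x))%E.
Proof.
move=> mh h0; rewrite -(fubini_tonelli1 (m1 := distribution P Zm) (m2 := distribution P Xm))//.
rewrite -[LHS](@ge0_integral_distribution _ _ _ _ _ P ZXm _ mh h0).
by apply/esym/eq_measure_integral => A mA _; exact: product_law.
Qed.

Lemma integral_mul_ge0 (u : R -> \bar R) (v : X -> \bar R) :
    measurable_fun setT u -> (forall z, 0 <= u z)%E ->
    measurable_fun setT v -> (forall x, 0 <= v x)%E ->
  (\int[P]_w (u (Z w) * v (Xs n w)) =
   \int[P]_w u (Z w) * \int[P]_w v (Xs n w))%E.
Proof.
move=> mu u0 mv v0.
rewrite (ge0_integral_product_law (h := fun p => u p.1 * v p.2)%E); last 2 first.
- by apply: emeasurable_funM; exact: measurableT_comp.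
- by move=> p; rewrite mule_ge0.
under eq_integral do rewrite /= ge0_integralZl//.
rewrite ge0_integralZr//; last by apply: integral_ge0.
by rewrite !ge0_integral_distribution.
Qed.

(** The product of two merely integrable variables is integrable because of
    independence. *)
Lemma integrable_mul (v : X -> R) :
    P.-integrable setT (EFin \o Z) -> measurable_fun setT v ->
    P.-integrable setT (EFin \o (v \o Xs n)) ->
  P.-integrable setT (EFin \o (fun w => Z w * v (Xs n w))).
Proof.
move=> /integrableP[mZE Zfin] mv /integrableP[mvE vfin]; apply/integrableP; split.
  by apply/measurable_EFinP; apply: measurable_funM => //; exact: measurableT_comp.
under eq_integral do rewrite /= normrM EFinM.
rewrite (integral_mul_ge0 (u := fun z => `|z|%:E) (v := fun x => `|v x|%:E))//.
- by rewrite lte_mul_pinfty ?integral_ge0// ge0_fin_numE ?integral_ge0.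
- by apply/measurable_EFinP; exact: normr_measurable.
- by apply/measurable_EFinP; exact: measurableT_comp.
Qed.

Lemma integral_mul_mean0 (v : X -> R) :
    P.-integrable setT (EFin \o Z) -> measurable_fun setT v ->
    P.-integrable setT (EFin \o (v \o Xs n)) ->
    (\int[P]_w (v (Xs n w))%:E = 0)%E ->
  (\int[P]_w (Z w * v (Xs n w))%:E = 0)%E.
Proof.
move=> iZ mv iv v0.
pose h (p : R * X) := (p.1 * v p.2)%:E.
have mh : measurable_fun setT h.
  apply/measurable_EFinP; apply: measurable_funM; first exact: measurable_fst.
  exact: measurableT_comp.
have iZv := integrable_mul iZ mv iv.
have ih : (distribution P Zm \x distribution P Xm)%E.-integrable setT h.
  apply/integrableP; split => //; have /integrableP[_] := iZv.
  rewrite fubini_tonelli1//; last exact: measurableT_comp.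
  rewrite -(ge0_integral_product_law (h := abse \o h))//.
    exact: measurableT_comp.
  by move=> p; exact: abse_ge0.
transitivity (\int[distribution P ZXm]_p h p)%E.
  by rewrite (@integral_distribution _ _ _ _ _ P ZXm).
rewrite (eq_measure_integral (distribution P Zm \x distribution P Xm)%E); last first.
  by move=> A mA _; apply/esym; exact: product_law.
rewrite -integral12_prod_meas1// integral0_eq// => z _.
rewrite /fubini_F /h /=; under eq_integral do rewrite EFinM.
rewrite integralZl//; last first.
  by apply: integrable_pushforward => //; exact/measurable_EFinP.
by rewrite (@integral_distribution _ _ _ _ _ P Xm) ?v0 ?mule0//; exact/measurable_EFinP.
Qed.

End product_law.

End independence_from_the_past.

(** * Square integrable random variables *)

Section square_integrable.
Context (R : realType) d (W : measurableType d) (P : probability W R).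
Implicit Types Y : W -> R.

Lemma square_integrable Y : measurable_fun setT Y ->
  (\int[P]_w (Y w ^+ 2)%:E < +oo)%E ->
  P.-integrable setT (EFin \o (fun w => Y w ^+ 2)).
Proof.
move=> mY Yfin; apply/integrableP; split.
  by apply/measurable_EFinP; exact: measurable_funX.
rewrite (eq_integral (fun w => (Y w ^+ 2)%:E))// => w _ /=.
by rewrite ger0_norm// sqr_ge0.
Qed.

Lemma square_integrable_integrable Y : measurable_fun setT Y ->
  (\int[P]_w (Y w ^+ 2)%:E < +oo)%E -> P.-integrable setT (EFin \o Y).
Proof.
move=> mY Yfin.
apply: (@le_integrable _ _ _ P _ measurableT _ (fun w => (1 + Y w ^+ 2)%:E)).
- exact/measurable_EFinP.
- move=> w _ /=; rewrite lee_fin [leRHS]ger0_norm ?addr_ge0 ?sqr_ge0//.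
  by rewrite -[Y w ^+ 2]real_normK ?num_real//; have := normr_ge0 (Y w); nra.
- under eq_fun do rewrite EFinD.
  apply: integrableD => //; last exact: square_integrable.
  exact: finite_measure_integrable_cst.
Qed.

(** Identities valid only on [D] can be used after restricting to it. *)
Lemma ge0_integral_full_measure (D : set W) (f : W -> \bar R) :
    measurable D -> P D = 1%E -> measurable_fun setT f -> (forall w, 0 <= f w)%E ->
  (\int[P]_w f w = \int[P]_(w in D) f w)%E.
Proof.
move=> mD PD mf f0; rewrite (@ge0_negligible_integral _ _ _ P setT (~` D))//.
- by rewrite setDE setCK setTI.
- exact: measurableC.
- by have := probability_setC P mD; rewrite PD subee.
Qed.

End square_integrable.

Section polarization.
Context (R : realType).

Lemma integrable_mul_of_squares d (S : measurableType d) (Q : {measure set S -> \bar R})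
    (u v : S -> R) : measurable_fun setT u -> measurable_fun setT v ->
    Q.-integrable setT (EFin \o (fun x => u x ^+ 2)) ->
    Q.-integrable setT (EFin \o (fun x => v x ^+ 2)) ->
  Q.-integrable setT (EFin \o (fun x => u x * v x)).
Proof.
move=> mu mv iu iv.
apply: (@le_integrable _ _ _ Q _ measurableT _ (fun x => (u x ^+ 2 + v x ^+ 2)%:E)).
- by apply/measurable_EFinP; exact: measurable_funM.
- move=> x _ /=; rewrite lee_fin [leRHS]ger0_norm ?addr_ge0 ?sqr_ge0//.
  rewrite normrM -(real_normK (num_real (u x))) -(real_normK (num_real (v x))).
  by have := sqr_ge0 (`|u x| - `|v x|); have := normr_ge0 (u x); nra.
- by under eq_fun do rewrite EFinD; exact: integrableD.
Qed.

Lemma integral_polarization d (S : measurableType d) (Q : {measure set S -> \bar R})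
    (u v : S -> R) : measurable_fun setT u -> measurable_fun setT v ->
    Q.-integrable setT (EFin \o (fun x => u x ^+ 2)) ->
    Q.-integrable setT (EFin \o (fun x => v x ^+ 2)) ->
  (\int[Q]_x ((u x + v x) ^+ 2)%:E =
   \int[Q]_x (u x ^+ 2)%:E + \int[Q]_x (v x ^+ 2)%:E
   + 2%:E * \int[Q]_x (u x * v x)%:E)%E.
Proof.
move=> mu mv iu iv; have iuv := integrable_mul_of_squares mu mv iu iv.
rewrite -integralZl// -!integralD//; [|exact: integrableD|exact: integrableZl].
by apply: eq_integral => x _; rewrite -EFinM -!EFinD; congr EFin; ring.
Qed.

Lemma square_sum_lty d (S : measurableType d) (Q : {measure set S -> \bar R})
    (u v : S -> R) : measurable_fun setT u -> measurable_fun setT v ->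
    Q.-integrable setT (EFin \o (fun x => u x ^+ 2)) ->
    Q.-integrable setT (EFin \o (fun x => v x ^+ 2)) ->
  (\int[Q]_x ((u x + v x) ^+ 2)%:E < +oo)%E.
Proof.
move=> mu mv iu iv; have iuv := integrable_mul_of_squares mu mv iu iv.
rewrite integral_polarization// ltey_eq; apply/orP; left.
rewrite fin_numD; apply/andP; split; first (rewrite fin_numD; apply/andP; split).
- exact: (integrable_fin_num measurableT iu).
- exact: (integrable_fin_num measurableT iv).
- by rewrite fin_numM//; exact: (integrable_fin_num measurableT iuv).
Qed.

(** A mixed product is a combination of the squares of [u], [v] and [u + v], so an
    identity between second moments extends to mixed moments. *)
Lemma integral_mul_of_squares d d' (S : measurableType d) (S' : measurableType d')
    (Q : {measure set S -> \bar R}) (Q' : {measure set S' -> \bar R})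
    (U V : S -> R) (u v : S' -> R) (c : R) :
    measurable_fun setT U -> measurable_fun setT V ->
    Q.-integrable setT (EFin \o (fun x => U x ^+ 2)) ->
    Q.-integrable setT (EFin \o (fun x => V x ^+ 2)) ->
    measurable_fun setT u -> measurable_fun setT v ->
    Q'.-integrable setT (EFin \o (fun x => u x ^+ 2)) ->
    Q'.-integrable setT (EFin \o (fun x => v x ^+ 2)) ->
    (\int[Q]_x (U x ^+ 2)%:E = c%:E * \int[Q']_x (u x ^+ 2)%:E)%E ->
    (\int[Q]_x (V x ^+ 2)%:E = c%:E * \int[Q']_x (v x ^+ 2)%:E)%E ->
    (\int[Q]_x ((U x + V x) ^+ 2)%:E = c%:E * \int[Q']_x ((u x + v x) ^+ 2)%:E)%E ->
  (\int[Q]_x (U x * V x)%:E = c%:E * \int[Q']_x (u x * v x)%:E)%E.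
Proof.
move=> mU mV iU iV mu mv iu iv UE VE.
have iUV := integrable_mul_of_squares mU mV iU iV.
have iuv := integrable_mul_of_squares mu mv iu iv.
rewrite !integral_polarization// UE VE.
have finE (E : \bar R) : E \is a fin_num -> exists x, E = x%:E.
  by move=> /fineK <-; exists (fine E).
have [x xE] : exists x, (\int[Q']_x (u x ^+ 2)%:E)%E = x%:E.
  exact: finE (integrable_fin_num measurableT iu).
have [y yE] : exists y, (\int[Q']_x (v x ^+ 2)%:E)%E = y%:E.
  exact: finE (integrable_fin_num measurableT iv).
have [z zE] : exists z, (\int[Q']_x (u x * v x)%:E)%E = z%:E.
  exact: finE (integrable_fin_num measurableT iuv).
have [t tE] : exists t, (\int[Q]_x (U x * V x)%:E)%E = t%:E.
  exact: finE (integrable_fin_num measurableT iUV).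
rewrite xE yE zE tE => E.
have [{}E] : (c * x + c * y + 2 * t)%:E = (c * (x + y + 2 * z))%:E by exact: E.
by suff -> : t = c * z by []; lra.
Qed.

End polarization.

(** * Wald's second identity *)

Section wald.
Context (R : realType) (dX dW : measure_display).
Context (X : measurableType dX) (W : measurableType dW).
Variables (P : probability W R) (Xs : nat -> W -> X).
Hypothesis mXs : forall k, measurable_fun setT (Xs k).
Hypothesis Xs_independent : forall n (A : nat -> set X),
  (forall k, measurable (A k)) ->
  P (\bigcap_(k in `I_n) (Xs k @^-1` A k)) = (\prod_(k < n) P (Xs k @^-1` A k))%E.
Hypothesis Xs_same_law : forall k A, measurable A ->
  P (Xs k @^-1` A) = P (Xs 0%N @^-1` A).
Variable N : W -> option nat.
Hypothesis N_stopping : is_stopping_time Xs N.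

(** The event on which observation number [k], counted from 0, is still taken. *)
Definition running (k : nat) (w : W) : bool :=
  if N w is Some n then (k < n)%N else true.

Definition stops : set W := [set w | N w <> None].

Lemma measurable_stops : measurable stops.
Proof.
rewrite (_ : stops = \bigcup_n [set w | N w = Some n]).
  apply: bigcup_measurable => n _.
  exact: (sample_sigma_algebra_measurable mXs (N_stopping.2 n)).
apply/seteqP; split => [w|w [n _] /= Nw]; rewrite /stops /=.
  by case Nw: (N w) => [n|] // _; exists n.
by rewrite Nw.
Qed.

(** Sampling goes on after [k] observations unless it has stopped at one of the
    times [0, ..., k], which the first [k] observations decide. *)
Lemma adapted_running k : adapted Xs k (fun w => (running k w)%:R : R).
Proof.
pose A := \bigcup_(n in `I_k.+1) [set w | N w = Some n].
have mA : @measurable _ (g_sigma_algebraType (past Xs k)) (~` A).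
  apply: measurableC; apply: bigcup_measurable => n /= nk.
  by apply: (sample_sigma_algebra_le (nk : (n <= k)%N)); exact: (N_stopping.2 n).
rewrite /adapted (_ : (fun w => _) = \1_(~` A)); first exact: measurable_indic.
apply/funext => w; rewrite indicE; congr (nat_of_bool _)%:R.
apply/idP/idP => [rw|/set_mem Aw].
  apply/mem_set => -[n /= nk Nw]; move: rw; rewrite /running Nw.
  by rewrite ltnNge -ltnS nk.
rewrite /running; case Nw: (N w) => [n|//]; rewrite ltnNge; apply/negP => nk.
by apply: Aw; exists n.
Qed.

Definition running_probability k : R := fine (\int[P]_w (running k w)%:R%:E)%E.

Lemma EFin_running_probability k :
  (running_probability k)%:E = (\int[P]_w (running k w)%:R%:E)%E.
Proof.
rewrite /running_probability fineK//.
rewrite ge0_fin_numE; last by apply: integral_ge0 => w _; rewrite lee_fin.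
apply: (@le_lt_trans _ _ (\int[P]_w (cst 1 w))%E); last first.
  by rewrite integral_cst// mul1e ltey_eq fin_num_measure.
apply: ge0_le_integral => //.
- apply/measurable_EFinP; exact: (adapted_measurable mXs (@adapted_running k)).
- by move=> w _; rewrite lee_fin; case: running.
Qed.

Lemma running_probability_ge0 k : 0 <= running_probability k.
Proof. by apply: fine_ge0; apply: integral_ge0 => w _; rewrite lee_fin. Qed.

(** [N] is the sum over [k] of the indicators of [k < N]; the terms are
    nonnegative, so sum and expectation may be exchanged. *)
Lemma expected_stopping_time_series p (Pf : 'rV[R]_p -> probability W R) theta :
  Pf theta = P ->
  expected_stopping_time Pf N theta =
  (\sum_(0 <= k <oo) (running_probability k)%:E)%E.
Proof.
move=> PfE; rewrite /expected_stopping_time PfE.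
under eq_eseriesr do rewrite EFin_running_probability.
rewrite -integral_nneseries//; last first.
  by move=> k; apply/measurable_EFinP; exact: (adapted_measurable mXs (@adapted_running k)).
apply: eq_integral => w _; rewrite /running; case: (N w) => [n|].
  rewrite (@nneseries_split _ _ 0 n)// [X in (_ + X)%E]eseries0 ?adde0; last first.
    by move=> k nk _; rewrite add0n in nk; rewrite ltnNge nk.
  rewrite add0n big_nat (eq_bigr (fun=> 1%E)); last by move=> k /andP[_ ->].
  rewrite -big_nat sumEFin; congr EFin.
  by rewrite sumr_const_nat subn0.
apply/esym/eq_infty => r.
(* Where [N] is infinite all terms are 1, so the partial sums are unbounded. *)
pose n := (Num.truncn `|r|).+1.
apply: (@le_trans _ _ (\sum_(0 <= k < n) 1%E)%E).
  rewrite sumEFin lee_fin sumr_const_nat subn0 (le_trans (ler_norm _))//.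
  by rewrite ltW// truncnS_gt.
exact: nneseries_lim_ge.
Qed.

Hypothesis stops_surely : P stops = 1%E.
Variable s : X -> R.
Hypothesis ms : measurable_fun setT s.
Hypothesis s_square : (\int[P]_w (s (Xs 0%N w) ^+ 2)%:E < +oo)%E.
Hypothesis s_mean0 : (\int[P]_w (s (Xs 0%N w))%:E = 0)%E.

Let ms_obs k : measurable_fun setT (s \o Xs k).
Proof. exact: measurableT_comp. Qed.

Let Xm k : {mfun W >-> X} := mfun_Sub (mem_set (mXs k)).

Lemma ge0_integral_obs k (f : X -> \bar R) : measurable_fun setT f ->
  (forall x, 0 <= f x)%E ->
  (\int[P]_w f (Xs k w) = \int[P]_w f (Xs 0%N w))%E.
Proof.
move=> mf f0.
rewrite -[LHS](@ge0_integral_distribution _ _ _ _ _ P (Xm k) _ mf f0).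
rewrite -[RHS](@ge0_integral_distribution _ _ _ _ _ P (Xm 0%N) _ mf f0).
by apply: eq_measure_integral => A mA _; exact: Xs_same_law.
Qed.

Lemma square_obs k :
  (\int[P]_w (s (Xs k w) ^+ 2)%:E = \int[P]_w (s (Xs 0%N w) ^+ 2)%:E)%E.
Proof.
apply: (ge0_integral_obs k (f := fun x => (s x ^+ 2)%:E)).
  by apply/measurable_EFinP; exact: measurable_funX.
by move=> x; rewrite lee_fin sqr_ge0.
Qed.

Lemma integrable_obs k : P.-integrable setT (EFin \o (s \o Xs k)).
Proof.
apply: square_integrable_integrable; first exact: ms_obs.
by rewrite square_obs.
Qed.

Lemma mean_obs k : (\int[P]_w (s (Xs k w))%:E = 0)%E.
Proof.
rewrite -s_mean0.
have msE : measurable_fun setT (EFin \o s) by exact/measurable_EFinP.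
rewrite -[LHS](@integral_distribution _ _ _ _ _ P (Xm k) _ msE); last exact: integrable_obs.
rewrite -[RHS](@integral_distribution _ _ _ _ _ P (Xm 0%N) _ msE); last exact: integrable_obs.
by apply: eq_measure_integral => A mA _; exact: Xs_same_law.
Qed.

Definition variance_obs : R := fine (\int[P]_w (s (Xs 0%N w) ^+ 2)%:E)%E.

Lemma EFin_variance_obs :
  (variance_obs)%:E = (\int[P]_w (s (Xs 0%N w) ^+ 2)%:E)%E.
Proof.
rewrite /variance_obs fineK// ge0_fin_numE//.
by apply: integral_ge0 => w _; rewrite lee_fin sqr_ge0.
Qed.

(** Sums from [k] to [n] rather than from 0 because the tails between two truncation
    times have to be estimated as well. *)
Definition stopped_sum (k n : nat) (w : W) : R :=
  \sum_(k <= i < n) (running i w)%:R * s (Xs i w).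

Lemma stopped_sumS k n w : (k <= n)%N ->
  stopped_sum k n.+1 w = stopped_sum k n w + (running n w)%:R * s (Xs n w).
Proof. by move=> kn; rewrite /stopped_sum big_nat_recr. Qed.

Lemma adapted_stopped_sum k n : adapted Xs n (stopped_sum k n).
Proof.
elim: n => [|n IH].
  rewrite (_ : stopped_sum k 0 = cst 0); first exact: measurable_cst.
  by apply/funext => w; rewrite /stopped_sum big_geq.
have [kn|nk] := leqP k n; last first.
  rewrite (_ : stopped_sum k n.+1 = cst 0); first exact: measurable_cst.
  by apply/funext => w; rewrite /stopped_sum big_geq.
rewrite (_ : stopped_sum k n.+1 =
    (fun w => stopped_sum k n w + (running n w)%:R * s (Xs n w))); last first.
  by apply/funext => w; exact: stopped_sumS.
apply: measurable_funD; first exact: adapted_le (leqnSn n) IH.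
apply: measurable_funM; first exact: adapted_le (leqnSn n) (@adapted_running n).
by apply: measurableT_comp => //; exact: (adapted_obs (ltnSn n)).
Qed.

Lemma measurable_stopped_sum k n : measurable_fun setT (stopped_sum k n).
Proof. exact: (adapted_measurable mXs (@adapted_stopped_sum k n)). Qed.

(** Orthogonality of the increments. The new term is the product of the indicator of
    [l < N] and of the earlier sum, both known from the first [l] observations, with
    an independent variable of mean zero, so the mixed term vanishes. *)
Lemma square_stopped_sum k n : (k <= n)%N ->
  (\int[P]_w (stopped_sum k n w ^+ 2)%:E =
   (variance_obs * \sum_(k <= i < n) running_probability i)%:E)%E.
Proof.
move=> /subnK <-; elim: (n - k)%N => [|d IH].
  rewrite big_geq// mulr0 integral0_eq// => w _.
  by rewrite /stopped_sum big_geq// expr0n.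
set l := (d + k)%N in IH *; have kl : (k <= l)%N by exact: leq_addl.
rewrite addSn -/l big_nat_recr//= mulrDr EFinD -IH.
pose Z w := (running l w)%:R * stopped_sum k l w.
have mr : measurable_fun setT (fun w => (running l w)%:R : R).
  exact: (adapted_measurable mXs (@adapted_running l)).
have Zl : adapted Xs l Z.
  by apply: measurable_funM; [exact: adapted_running|exact: adapted_stopped_sum].
have mT := @measurable_stopped_sum k l.
have Tfin : (\int[P]_w (stopped_sum k l w ^+ 2)%:E < +oo)%E by rewrite IH ltry.
have iT2 := square_integrable mT Tfin.
have iZ : P.-integrable setT (EFin \o Z).
  apply: le_integrable (square_integrable_integrable mT Tfin) => //.
    by apply/measurable_EFinP; exact: (adapted_measurable mXs Zl).
  by move=> w _; rewrite /Z /= lee_fin; case: running; rewrite ?mul1r// mul0r normr0.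
have iZs := integrable_mul mXs Xs_independent Zl iZ ms (integrable_obs l).
(* The square of the increment; the indicator is its own square. *)
pose J w := (running l w)%:R * s (Xs l w) ^+ 2.
have JE : (\int[P]_w (J w)%:E = (variance_obs * running_probability l)%:E)%E.
  have mu : measurable_fun setT (fun z : R => `|z|%:E).
    by apply/measurable_EFinP; exact: normr_measurable.
  have mv : measurable_fun setT (fun x => (s x ^+ 2)%:E).
    by apply/measurable_EFinP; exact: measurable_funX.
  have v0 x : (0 <= (s x ^+ 2)%:E)%E by rewrite lee_fin sqr_ge0.
  rewrite mulrC EFinM EFin_running_probability EFin_variance_obs -(square_obs l).
  have := integral_mul_ge0 mXs Xs_independent (@adapted_running l) mu
    (fun z => normr_ge0 z) mv v0.
  rewrite /= => E; rewrite [X in (X * _)%E](_ : _ =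
    (\int[P]_w `|(running l w)%:R : R|%:E)%E); last first.
    by apply: eq_integral => w _; rewrite ger0_norm.
  by rewrite -E; apply: eq_integral => w _; rewrite /J EFinM ger0_norm.
have mJ : measurable_fun setT J.
  by apply: measurable_funM => //; apply: measurable_funX; exact: ms_obs.
have iJ : P.-integrable setT (EFin \o J).
  apply/integrableP; split; first exact/measurable_EFinP.
  rewrite (eq_integral (fun w => (J w)%:E)) ?JE ?ltry// => w _ /=.
  by rewrite ger0_norm// mulr_ge0// sqr_ge0.
have iZs2 := integrableZl measurableT 2 iZs.
transitivity (\int[P]_w ((stopped_sum k l w ^+ 2)%:E +
    (2%:E * (Z w * s (Xs l w))%:E + (J w)%:E)))%E.
  apply: eq_integral => w _; rewrite stopped_sumS// -EFinM -!EFinD /Z /J; congr EFin.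
  by case: running; rewrite /= ?mul1r ?mul0r; ring.
rewrite integralD//; last exact: integrableD.
rewrite integralD// integralZl// (integral_mul_mean0 mXs Xs_independent Zl)//.
- by rewrite mule0 add0e JE.
- exact: integrable_obs.
- exact: mean_obs.
Qed.

Definition stopped_score (w : W) : R :=
  if N w is Some n then \sum_(k < n) s (Xs k w) else 0.

Lemma stopped_sum_stopped k n w m : N w = Some m ->
  stopped_sum k n w = \sum_(k <= i < minn m n) s (Xs i w).
Proof.
move=> Nw; rewrite /stopped_sum /running Nw.
have [kn|nk] := leqP k n; last first.
  by rewrite !big_geq// ?(ltnW nk)// (leq_trans (geq_minr _ _))// ltnW.
rewrite [RHS](big_nat_widen _ _ n); last exact: geq_minr.
rewrite [RHS]big_mkcond /= big_nat_cond [RHS]big_nat_cond; apply: eq_bigr.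
move=> i /andP[/andP[_ iN] _]; rewrite leq_min iN andbT.
by case: ltnP; rewrite ?mul1r ?mul0r.
Qed.

Lemma stopped_sum_le w m n : N w = Some m -> (m <= n)%N ->
  stopped_sum 0 n w = stopped_score w.
Proof.
move=> Nw mn; rewrite (stopped_sum_stopped _ _ Nw) /stopped_score Nw.
by rewrite (minn_idPl mn) big_mkord.
Qed.

(** Where sampling never stops, the sums need not converge; cutting them off there
   makes the convergence to [stopped_score] hold everywhere. *)
Let U n w : R := stopped_sum 0 n w * \1_stops w.

Let near_U w : \forall n \near \oo, U n w = stopped_score w.
Proof.
case Nw: (N w) => [m|]; last first.
  have nstop : ~ stops w by rewrite /stops /= Nw; apply.
  by apply: nearW => n; rewrite /U /stopped_score Nw indicE memNset ?mulr0.
have stop : stops w by rewrite /stops /= Nw.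
by exists m => // n /= mn; rewrite /U (stopped_sum_le Nw mn) indicE mem_set ?mulr1.
Qed.

Let mU n : measurable_fun setT (U n).
Proof.
apply: measurable_funM; first exact: measurable_stopped_sum.
exact: (measurable_indic measurable_stops).
Qed.

Lemma measurable_stopped_score : measurable_fun setT stopped_score.
Proof.
apply: (measurable_fun_cvg (h := U)) => [n|w _]; first exact: mU.
exact: cvg_near_cst.
Qed.

Variable e : R.
Hypothesis eE : (\sum_(0 <= k <oo) (running_probability k)%:E)%E = e%:E.

Let E n : R := \sum_(0 <= k < n) running_probability k.

Let E_le n : E n <= e.
Proof.
rewrite -lee_fin -eE /E -sumEFin; apply: nneseries_lim_ge => k _ _.
by rewrite lee_fin running_probability_ge0.
Qed.

Let E_cvg : E n @[n --> \oo] --> e.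
Proof.
have /fine_cvgP[_] : (E n)%:E @[n --> \oo] --> e%:E; last exact.
rewrite -eE; under eq_fun do rewrite /E -sumEFin.
by apply: is_cvg_nneseries => k _ _; rewrite lee_fin running_probability_ge0.
Qed.

Let variance_ge0 : 0 <= variance_obs.
Proof. by apply: fine_ge0; apply: integral_ge0 => w _; rewrite lee_fin sqr_ge0. Qed.

(** By Fatou's lemma along [n], for the sums between [m] and [n]. *)
Lemma square_tail_le m :
  (\int[P]_w ((stopped_score w - U m w) ^+ 2)%:E <=
   (variance_obs * (e - E m))%:E)%E.
Proof.
pose f n w := ((U n w - U m w) ^+ 2)%:E.
have mf n : measurable_fun setT (f n).
  apply/measurable_EFinP; apply: measurable_funX; apply: measurable_funB; exact: mU.
have f0 n w : (0 <= f n w)%E by rewrite lee_fin sqr_ge0.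
rewrite (eq_integral (fun w => limn_einf (f ^~ w))); last first.
  move=> w _; apply/esym.
  apply: (cvg_limn_einf_sup (l := ((stopped_score w - U m w) ^+ 2)%:E) _).1.
  by apply: cvg_near_cst; apply: filterS (near_U w) => n; rewrite /f => ->.
apply: le_trans; first by apply: fatou => // n; exact: mf.
rewrite limn_einf_lim; apply: lime_le; first exact: is_cvg_einfs.
apply: nearW => n; apply: ge_ereal_inf.
(* The lower limit is bounded by terms of arbitrarily large index, here [>= m]. *)
exists (\int[P]_w f (maxn n m) w)%E.
  by exists (maxn n m) => //=; exact: leq_maxl.
have mk : (m <= maxn n m)%N by exact: leq_maxr.
move: (maxn n m) mk => k mk.
apply: (@le_trans _ _ (\int[P]_w (stopped_sum m k w ^+ 2)%:E)%E).
  apply: ge0_le_integral => //.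
  - by apply/measurable_EFinP; apply: measurable_funX; exact: measurable_stopped_sum.
  - move=> w _; rewrite lee_fin /U -mulrBl /stopped_sum (big_cat_nat _ mk)//=.
    rewrite [X in X - _]addrC addrK exprMn indicE.
    by case: (_ \in _); rewrite ?expr1n ?mulr1// expr0n mulr0 sqr_ge0.
rewrite square_stopped_sum// lee_fin ler_wpM2l// lerBrDr.
by have := E_le k; rewrite /E (big_cat_nat _ mk)//= addrC.
Qed.

(** The truncated sums converge to the stopped one in mean square, and their second
    moments tend to [variance_obs * e]. The upper bound is Fatou's; the lower one
    compares [y ^ 2] with [x ^ 2] and [(x - y) ^ 2] by the inequality
    [y ^ 2 <= (1 + eps) x ^ 2 + (1 + 1 / eps) (x - y) ^ 2], first letting the
    truncation go to infinity and then [eps] to 0. *)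
Lemma square_stopped_score :
  (\int[P]_w (stopped_score w ^+ 2)%:E = (variance_obs * e)%:E)%E.
Proof.
have mS2 : measurable_fun setT (fun w => (stopped_score w ^+ 2)%:E).
  by apply/measurable_EFinP; apply: measurable_funX; exact: measurable_stopped_score.
have S0 w : setT w -> (0 <= (stopped_score w ^+ 2)%:E)%E.
  by move=> _; rewrite lee_fin sqr_ge0.
have Sle : (\int[P]_w (stopped_score w ^+ 2)%:E <= (variance_obs * e)%:E)%E.
  have := square_tail_le 0.
  rewrite /E big_geq// subr0; congr (_ <= _)%E; apply: eq_integral => w _.
  by rewrite /U /stopped_sum big_geq// mul0r subr0.
have [a aE] : exists a, (\int[P]_w (stopped_score w ^+ 2)%:E)%E = a%:E.
  exists (fine (\int[P]_w (stopped_score w ^+ 2)%:E)%E); rewrite fineK//.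
  by rewrite ge0_fin_numE ?(le_lt_trans Sle) ?ltry// integral_ge0.
have a0 : 0 <= a by rewrite -lee_fin -aE integral_ge0.
rewrite aE in Sle *; congr EFin; apply/eqP; rewrite eq_le -lee_fin Sle /=.
have approx eps m : 0 < eps -> variance_obs * E m <=
    (1 + eps) * a + (1 + eps^-1) * (variance_obs * (e - E m)).
  move=> eps0; rewrite -lee_fin -square_stopped_sum//.
  have mT2 : measurable_fun setT (fun w => (stopped_sum 0 m w ^+ 2)%:E).
    by apply/measurable_EFinP; apply: measurable_funX; exact: measurable_stopped_sum.
  rewrite (ge0_integral_full_measure measurable_stops stops_surely mT2); last first.
    by move=> w; rewrite lee_fin sqr_ge0.
  have mD2 : measurable_fun setT (fun w => ((stopped_score w - U m w) ^+ 2)%:E).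
    apply/measurable_EFinP; apply: measurable_funX.
    by apply: measurable_funB; [exact: measurable_stopped_score|exact: mU].
  have D0 w : setT w -> (0 <= ((stopped_score w - U m w) ^+ 2)%:E)%E.
    by move=> _; rewrite lee_fin sqr_ge0.
  have eps1 : 0 <= 1 + eps by rewrite addr_ge0// ltW.
  have eps2 : 0 <= 1 + eps^-1 by rewrite addr_ge0// invr_ge0 ltW.
  apply: (@le_trans _ _ (\int[P]_w ((1 + eps)%:E * (stopped_score w ^+ 2)%:E +
      (1 + eps^-1)%:E * ((stopped_score w - U m w) ^+ 2)%:E))%E).
    apply: (@le_trans _ _ (\int[P]_(w in stops) ((1 + eps)%:E * (stopped_score w ^+ 2)%:E +
      (1 + eps^-1)%:E * ((stopped_score w - U m w) ^+ 2)%:E))%E); last first.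
      apply: ge0_subset_integral => //; first exact: measurable_stops.
        by apply: emeasurable_funD; apply: emeasurable_funM.
      by move=> w _; rewrite adde_ge0// mule_ge0// ?lee_fin// sqr_ge0.
    apply: ge0_le_integral => //.
    - exact: measurable_stops.
    - by move=> w _; rewrite lee_fin sqr_ge0.
    - exact: measurable_funTS.
    - by apply: measurable_funTS; apply: emeasurable_funD; apply: emeasurable_funM.
    - move=> w sw; rewrite -!EFinM -EFinD lee_fin.
      have -> : stopped_sum 0 m w = U m w by rewrite /U indicE mem_set// mulr1.
      set x := stopped_score w; set y := U m w.
      (* Completing the square: the last term is what the inequality drops. *)
      have -> : y ^+ 2 = (1 + eps) * x ^+ 2 + (1 + eps^-1) * (x - y) ^+ 2
                       - eps^-1 * (eps * x + (x - y)) ^+ 2.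
        by field; rewrite gt_eqF.
      by rewrite lerBlDr lerDl mulr_ge0 ?sqr_ge0// invr_ge0 ltW.
  rewrite ge0_integralD//; last 4 first.
  - by move=> w _; rewrite mule_ge0// ?lee_fin// sqr_ge0.
  - exact: emeasurable_funM.
  - by move=> w _; rewrite mule_ge0// ?lee_fin// sqr_ge0.
  - exact: emeasurable_funM.
  rewrite !ge0_integralZl_EFin// aE [X in (_ <= X)%E]EFinD.
  rewrite [X in (_ <= X + _)%E]EFinM [X in (_ <= _ + X)%E]EFinM.
  rewrite leeD2l// lee_wpmul2l ?lee_fin//.
  exact: square_tail_le.
have le_eps eps : 0 < eps -> variance_obs * e <= (1 + eps) * a.
  move=> eps0; rewrite [leRHS](_ : _ = (1 + eps) * a +
    (1 + eps^-1) * (variance_obs * (e - e))); last by rewrite subrr !mulr0 addr0.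
  apply: (ler_cvg_to (f := fun m => variance_obs * E m)
    (g := fun m => (1 + eps) * a + (1 + eps^-1) * (variance_obs * (e - E m))) (a := \oo)).
  - by apply: cvgMl_tmp; exact: E_cvg.
  - apply: cvgD; first exact: cvg_cst.
    by do 2 apply: cvgMl_tmp; apply: cvgB; [exact: cvg_cst|exact: E_cvg].
  - by apply: nearW => m; exact: approx.
apply/ler_addgt0Pr => d d0.
have a1 : 0 < a + 1 by rewrite ltr_wpDl.
(* [eps = d / (a + 1)] makes [eps * a <= d], also when [a = 0]. *)
apply: le_trans (le_eps (d / (a + 1)) _) _; first by rewrite divr_gt0.
rewrite mulrDl mul1r lerD2l mulrAC ler_pdivrMr// ler_wpM2l ?(ltW d0)//.
by rewrite lerDl.
Qed.

End wald.

(** * Fisher information of the sequential experiment *)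

Section law_with_density.
Context (R : realType) (dX dW : measure_display).
Context (X : measurableType dX) (W : measurableType dW).
Variables (P : probability W R) (Z : W -> X).
Variables (nu : {sigma_finite_measure set X -> \bar R}) (F : X -> R).
Hypothesis mZ : measurable_fun setT Z.
Hypothesis mF : measurable_fun setT F.
Hypothesis F0 : forall x, 0 <= F x.
Hypothesis law : forall A, measurable A ->
  P (Z @^-1` A) = (\int[nu]_(x in A) (F x)%:E)%E.
Local Open Scope ereal_scope.

Let Zm : {mfun W >-> X} := mfun_Sub (mem_set mZ).

(** The law of [Z] is dominated by [nu], and [F] agrees almost everywhere with its
    Radon-Nikodym derivative, since both have the same integrals. *)
Lemma ge0_integral_law (phi : X -> \bar R) : measurable_fun setT phi ->
  (forall x, 0 <= phi x) ->
  \int[P]_w phi (Z w) = \int[nu]_x (phi x * (F x)%:E).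
Proof.
move=> mphi phi0; have mFE : measurable_fun setT (EFin \o F) by exact/measurable_EFinP.
have dom : distribution P Zm `<< nu.
  apply/null_content_dominatesP => A mA nuA; apply: etrans (law mA) _.
  by apply: null_set_integral => //; exact: measurable_funTS.
rewrite -[LHS](@ge0_integral_distribution _ _ _ _ _ P Zm _ mphi phi0).
rewrite -(Radon_Nikodym_SigmaFinite.change_of_variables dom phi0 measurableT mphi).
pose g := Radon_Nikodym_SigmaFinite.f (distribution P Zm) nu.
have ig : nu.-integrable setT g by exact: Radon_Nikodym_SigmaFinite.f_integrable.
have gF : ae_eq nu setT g (EFin \o F).
  apply: integral_ae_eq => // A _ mA.
  by rewrite -Radon_Nikodym_SigmaFinite.f_integral//; exact: law.
apply: ae_eq_integral => //.
- by apply: emeasurable_funM => //; exact: measurable_int ig.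
- exact: emeasurable_funM.
- exact: ae_eqe_mul2l.
Qed.

Lemma integral_law (phi : X -> R) : measurable_fun setT phi ->
  \int[P]_w (phi (Z w))%:E = \int[nu]_x (phi x * F x)%:E.
Proof.
move=> mphi; have mphiE : measurable_fun setT (EFin \o phi) by exact/measurable_EFinP.
rewrite integralE [RHS]integralE; congr (_ - _).
- transitivity (\int[P]_w (EFin \o phi)^\+ (Z w)).
    by apply: eq_integral => w _; rewrite !funeposE.
  rewrite ge0_integral_law//; last exact: measurable_funepos.
  apply: eq_integral => x _; rewrite !funeposE /= -!EFin_max -EFinM maxr_pMl//.
  by rewrite mul0r.
- transitivity (\int[P]_w (EFin \o phi)^\- (Z w)).
    by apply: eq_integral => w _; rewrite !funenegE.
  rewrite ge0_integral_law//; last exact: measurable_funeneg.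
  apply: eq_integral => x _; rewrite !funenegE /= -!EFin_max -EFinM maxr_pMl//.
  by rewrite mul0r mulNr.
Qed.

End law_with_density.

Section directional_derivative.
Context (R : realType) (V : normedModType R).

(** Reduces the chain rule for a directional derivative to that for functions of one
    variable. *)
Lemma derive_line (F : V -> R) (theta v : V) :
  'D_v F theta = 'D_1 (fun h : R => F (h *: v + theta)) 0.
Proof.
rewrite /derive; set g1 := fun h => h^-1 *: _; set g2 := fun h => h^-1 *: _.
suff -> : g1 = g2 by [].
apply/funext => h; rewrite /g1 /g2 /=.
by rewrite addr0 scale0r add0r [_%:A]mulr1.
Qed.

Lemma is_derive_ln (F : V -> R) (theta v : V) : 0 < F theta ->
  derivable F theta v ->
  is_derive theta v (fun t => ln (F t)) ('D_v F theta / F theta).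
Proof.
move=> F0 dF; pose G (h : R) := F (h *: v + theta).
have G0 : G 0 = F theta by rewrite /G scale0r add0r.
have dG : is_derive (0 : R) 1 G ('D_v F theta).
  by rewrite derive_line; apply: DeriveDef => //; exact: (derivable1P _ _ _).1.
have dln : is_derive (G 0) 1 (@ln R) (F theta)^-1.
  by rewrite G0; exact: is_derive1_ln.
have [dlnG eqlnG] := is_derive1_comp dln dG.
apply: DeriveDef; first exact: (derivable1P _ _ _).2.
by rewrite derive_line -[RHS]mulrC -eqlnG.
Qed.

End directional_derivative.

Lemma measurable_funV d (T : measurableType d) (R : realType) (g : T -> R) :
  measurable_fun setT g -> measurable_fun setT (fun x => (g x)^-1).
Proof.
move=> mg; apply: (@measurableT_comp _ _ _ _ _ _ (@GRing.inv R)) => //.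
(* Inversion is continuous away from 0, and a single point does not matter. *)
have -> : [set: R] = [set x | x != 0] `|` [set 0].
  by apply/seteqP; split => // x _; have [->|] := eqVneq x 0; [right|left].
have o0 : open [set x : R | x != 0] by exact: open_neq.
apply/measurable_funU => //; first exact: open_measurable.
split; last exact: measurable_fun_set1.
apply: open_continuous_measurable_fun => // x /set_mem x0.
exact: inv_continuous.
Qed.

Section scores.
Context (R : realType) (p : nat) (dX dW : measure_display).
Context (X : measurableType dX) (W : measurableType dW).
Variable Theta : set 'rV[R]_p.
Hypothesis Theta_open : open Theta.
Variables (nu : {sigma_finite_measure set X -> \bar R}) (f : 'rV[R]_p -> X -> R).
Hypothesis f_regular : regular_density Theta nu f.
Variables (P : 'rV[R]_p -> probability W R) (Xs : nat -> W -> X).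
Hypothesis Xs_iid : iid_with_density Theta P Xs nu f.
Variable theta : 'rV[R]_p.
Hypothesis theta_in : Theta theta.

(** Where the density vanishes, division by zero gives 0, which is also the derivative
    of the logarithm there. *)
Definition score (a : 'I_p) (x : X) : R := partial a (f ^~ x) theta / f theta x.

Let near_Theta : \forall t \near theta, Theta t.
Proof. exact: open_nbhs_nbhs. Qed.

(** The densities have a common support. *)
Lemma density_eq0 x t : Theta t -> f theta x = 0 -> f t x = 0.
Proof.
move=> Tt fx0; apply/eqP; rewrite eq_le (density_ge0 f_regular Tt) andbT leNgt.
apply/negP => /(density_support f_regular Tt theta_in).
by rewrite fx0 ltxx.
Qed.

Lemma near_const_partial a (F : 'rV[R]_p -> R) c :
  (\forall t \near theta, F t = c) -> partial a F theta = 0.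
Proof. by move=> Fc; rewrite /partial (near_eq_derive (g := cst c))// derive_cst. Qed.

Lemma partial_density_eq0 a x : f theta x = 0 -> partial a (f ^~ x) theta = 0.
Proof.
move=> fx0; apply: (@near_const_partial _ _ 0).
by apply: filterS near_Theta => t Tt; exact: density_eq0.
Qed.

(** Where the density vanishes it does so for all parameters close by, and the
    logarithm of 0 is the constant 0. *)
Lemma partial_ln_density a x : partial a (fun t => ln (f t x)) theta = score a x.
Proof.
have := density_ge0 f_regular theta_in x; rewrite le_eqVlt => /predU1P[/esym fx0|fx0].
  rewrite /score fx0 invr0 mulr0; apply: (@near_const_partial _ _ 0).
  by apply: filterS near_Theta => t Tt; rewrite density_eq0// ln0.
have dfx := @density_derivable _ _ _ _ _ _ _ f_regular _ theta_in a x.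
by have [_] := is_derive_ln fx0 dfx; rewrite /partial => ->.
Qed.

Lemma score_mul_density a x : score a x * f theta x = partial a (f ^~ x) theta.
Proof.
have [fx0|fx0] := eqVneq (f theta x) 0; last by rewrite mulfVK.
by rewrite fx0 mulr0 partial_density_eq0.
Qed.

Lemma measurable_score a : measurable_fun setT (score a).
Proof.
apply: measurable_funM.
  have /integrableP[/measurable_EFinP] := density_partial_integrable f_regular theta_in a.
  by [].
by apply: measurable_funV; exact: (density_measurable f_regular theta_in).
Qed.

Let mXs k : measurable_fun setT (Xs k) := Xs_iid.1 k.

(** Differentiate the constant [\int f = 1] under the integral sign. *)
Lemma score_mean0 a : (\int[P theta]_w (score a (Xs 0%N w))%:E = 0)%E.
Proof.
have [law _] := Xs_iid.2 _ theta_in.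
rewrite (integral_law (mXs 0) (density_measurable f_regular theta_in)
  (density_ge0 f_regular theta_in) (law 0%N) (measurable_score a)).
under eq_integral do rewrite score_mul_density.
have iF := density_partial_integrable f_regular theta_in a.
rewrite -[LHS]fineK; last by apply: integrable_fin_num.
have := density_interchange f_regular theta_in a; rewrite /Rintegral => <-.
congr EFin; apply: (@near_const_partial _ _ 1).
apply: filterS near_Theta => t Tt.
by rewrite /Rintegral (density_int1 f_regular Tt).
Qed.

Lemma score_square a :
  (\int[P theta]_w (score a (Xs 0%N w) ^+ 2)%:E < +oo)%E.
Proof.
have [law _] := Xs_iid.2 _ theta_in.
have m2 : measurable_fun setT (fun x => score a x ^+ 2).
  by apply: measurable_funX; exact: measurable_score.
rewrite (integral_law (mXs 0) (density_measurable f_regular theta_in)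
  (density_ge0 f_regular theta_in) (law 0%N) m2).
have := density_score_square f_regular theta_in a.
by under eq_integral do rewrite partial_ln_density.
Qed.

Variable N : W -> option nat.

(** The derivative fails to be the stopped sum of the scores only where some observed
    factor vanishes: there the likelihood is 0 around [theta], although the other
    observations may have non-zero scores. *)
Lemma partial_ln_sequential_likelihood a w :
  partial a (fun t => ln (sequential_likelihood f Xs N t w)) theta =
  if `[< exists2 n, N w = Some n & exists2 k, (k < n)%N & f theta (Xs k w) = 0 >]
  then 0 else stopped_score Xs N (score a) w.
Proof.
case: asboolP => [[n Nw [k kn fk0]]|nfk0].
  apply: (@near_const_partial _ _ 0); apply: filterS near_Theta => t Tt.
  rewrite /sequential_likelihood Nw (bigD1 (Ordinal kn))//= density_eq0// mul0r.
  by rewrite ln0.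
rewrite /stopped_score; case Nw: (N w) => [n|]; last first.
  apply: (@near_const_partial _ _ 0); apply: filterS near_Theta => t _.
  by rewrite /sequential_likelihood Nw ln1.
have fgt0 (k : 'I_n) t : Theta t -> 0 < f t (Xs k w).
  move=> Tt; apply: (density_support f_regular theta_in Tt).
  rewrite lt_neqAle (density_ge0 f_regular theta_in) andbT eq_sym.
  by apply/eqP => fk0; apply: nfk0; exists n => //; exists k.
have dln (k : 'I_n) : is_derive theta (delta_mx 0 a) (fun t => ln (f t (Xs k w)))
    (score a (Xs k w)).
  apply: is_derive_ln; first exact: fgt0.
  exact: (@density_derivable _ _ _ _ _ _ _ f_regular _ theta_in).
have lnE : \forall t \near theta, ln (sequential_likelihood f Xs N t w) =
    (\sum_(k < n) (fun t => ln (f t (Xs k w)))) t.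
  apply: filterS near_Theta => t Tt.
  by rewrite /sequential_likelihood Nw fct_sumE ln_prod_gt0// => k; exact: fgt0.
rewrite /partial (near_eq_derive _ lnE) derive_sum.
  by apply: eq_bigr => k _; have [] := dln k.
by move=> k; have [] := dln k.
Qed.

Hypothesis N_stopping : is_stopping_time Xs N.
Hypothesis N_proper : P theta [set w | N w <> None] = 1%E.
Variable e : R.
Hypothesis EN : expected_stopping_time P N theta = e%:E.

Let indep : forall n (A : nat -> set X), (forall k, measurable (A k)) ->
  P theta (\bigcap_(k in `I_n) (Xs k @^-1` A k)) =
  (\prod_(k < n) P theta (Xs k @^-1` A k))%E.
Proof. by have [_] := Xs_iid.2 _ theta_in. Qed.

Let same_law k A : measurable A ->
  P theta (Xs k @^-1` A) = P theta (Xs 0%N @^-1` A).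
Proof. by move=> mA; have [law _] := Xs_iid.2 _ theta_in; rewrite !law. Qed.

Let runningE : (\sum_(0 <= k <oo) (running_probability (P theta) N k)%:E)%E = e%:E.
Proof.
rewrite -EN; apply/esym.
exact: (expected_stopping_time_series mXs N_stopping (Pf := P)).
Qed.

(** Wald's second identity for an arbitrary function [s], since polarization needs it
    for sums of scores too. *)
Lemma square_stopped_score_E (s : X -> R) : measurable_fun setT s ->
    (\int[P theta]_w (s (Xs 0%N w) ^+ 2)%:E < +oo)%E ->
    (\int[P theta]_w (s (Xs 0%N w))%:E = 0)%E ->
  (\int[P theta]_w (stopped_score Xs N s w ^+ 2)%:E =
   e%:E * \int[P theta]_w (s (Xs 0%N w) ^+ 2)%:E)%E.
Proof.
move=> ms s2 s0.
rewrite (square_stopped_score mXs indep same_law N_stopping N_proper ms s2 s0 runningE).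
by rewrite mulrC EFinM EFin_variance_obs.
Qed.

Let m0 a : measurable_fun setT (fun w => score a (Xs 0%N w)).
Proof. by apply: measurableT_comp; [exact: measurable_score|exact: mXs]. Qed.

Let i0 a : (P theta).-integrable setT (EFin \o (fun w => score a (Xs 0%N w) ^+ 2)).
Proof. by apply: square_integrable; [exact: m0|exact: score_square]. Qed.

Lemma stopped_scoreD (s t : X -> R) w :
  stopped_score Xs N (fun x => s x + t x) w =
  stopped_score Xs N s w + stopped_score Xs N t w.
Proof.
by rewrite /stopped_score; case: (N w) => [n|]; rewrite ?addr0// big_split.
Qed.

Let mS c : measurable_fun setT (stopped_score Xs N (score c)).
Proof. exact: (measurable_stopped_score mXs N_stopping (@measurable_score c)). Qed.

Let iS c : (P theta).-integrable setT
  (EFin \o (fun w => stopped_score Xs N (score c) w ^+ 2)).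
Proof.
apply: square_integrable; first exact: mS.
rewrite (square_stopped_score_E (@measurable_score c) (score_square c) (score_mean0 c)).
by rewrite ltey_eq fin_numM//; exact: (integrable_fin_num measurableT (i0 c)).
Qed.

Lemma integral_stopped_score_mul a b :
  (\int[P theta]_w (stopped_score Xs N (score a) w * stopped_score Xs N (score b) w)%:E =
   e%:E * \int[P theta]_w (score a (Xs 0%N w) * score b (Xs 0%N w))%:E)%E.
Proof.
apply: integral_mul_of_squares (mS a) (mS b) (iS a) (iS b) (m0 a) (m0 b) (i0 a) (i0 b) _ _ _.
- exact: (square_stopped_score_E (@measurable_score a) (score_square a) (score_mean0 a)).
- exact: (square_stopped_score_E (@measurable_score b) (score_square b) (score_mean0 b)).
have msum : measurable_fun setT (fun x => score a x + score b x).
  by apply: measurable_funD; exact: measurable_score.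
rewrite -(square_stopped_score_E msum); last 2 first.
- exact: (square_sum_lty (m0 a) (m0 b) (i0 a) (i0 b)).
- have i1 c : (P theta).-integrable setT (EFin \o (fun w => score c (Xs 0%N w))).
    by apply: square_integrable_integrable; [exact: m0|exact: score_square].
  under eq_integral do rewrite EFinD.
  by rewrite (integralD measurableT (i1 a) (i1 b)) !score_mean0 adde0.
by apply: eq_integral => w _; rewrite stopped_scoreD.
Qed.

(** Observations at which the density vanishes have probability zero. *)
Lemma sequential_information_score a b :
  (\int[P theta]_w (partial a (fun t => ln (sequential_likelihood f Xs N t w)) theta *
     partial b (fun t => ln (sequential_likelihood f Xs N t w)) theta)%:E =
   \int[P theta]_w (stopped_score Xs N (score a) w * stopped_score Xs N (score b) w)%:E)%E.
Proof.
have iab := integrable_mul_of_squares (mS a) (mS b) (iS a) (iS b).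
(* The null event on which an observed factor vanishes. *)
pose B := \bigcup_n ([set w | N w = Some n] `&`
  \bigcup_(k in `I_n) (Xs k @^-1` [set x | f theta x = 0])).
have m0f : measurable [set x | f theta x = 0].
  have := density_measurable f_regular theta_in measurableT (measurable_set1 0).
  by rewrite setTI.
have mpre k : measurable (Xs k @^-1` [set x | f theta x = 0]).
  by rewrite -[X in measurable X]setTI; exact: mXs.
have mB : measurable B.
  apply: bigcup_measurable => n _; apply: measurableI.
    exact: (sample_sigma_algebra_measurable mXs (N_stopping.2 n)).
  by apply: bigcup_measurable => k _; exact: mpre.
have Pf0 k : P theta (Xs k @^-1` [set x | f theta x = 0]) = 0%E.
  have [law _] := Xs_iid.2 _ theta_in; rewrite law// integral0_eq// => x /= ->.
  by [].
have PB : P theta B = 0%E.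
  apply/eqP; rewrite eq_le measure_ge0 andbT.
  have sub : B `<=` \bigcup_k (Xs k @^-1` [set x | f theta x = 0]).
    by move=> w [n _ [_ [k _ fk]]]; exists k.
  apply: (le_trans (measure_sigma_subadditive (P theta) mpre mB sub)).
  by rewrite eseries0// => k _ _; exact: Pf0.
rewrite [RHS](negligible_integral mB)// setTD.
rewrite [RHS]integral_mkcond; apply: eq_integral => w _.
rewrite !partial_ln_sequential_likelihood patchE.
have -> : (w \in ~` B) = ~~ `[< exists2 n, N w = Some n &
    exists2 k, (k < n)%N & f theta (Xs k w) = 0 >].
  rewrite in_setC; congr (~~ _); apply/idP/asboolP => [/set_mem[n _ [Nw [k kn fk]]]|].
    by exists n => //; exists k.
  by move=> [n Nw [k kn fk]]; apply/mem_set; exists n => //; split => //; exists k.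
by case: asboolP => _ //=; rewrite mulr0.
Qed.

Lemma sequential_informationE :
  sequential_information P f Xs N theta = e *: single_information P f Xs theta.
Proof.
apply/matrixP => a b; rewrite !mxE unlock sequential_information_score.
rewrite integral_stopped_score_mul.
have iab := integrable_mul_of_squares (m0 a) (m0 b) (i0 a) (i0 b).
rewrite fineM//; last exact: (integrable_fin_num measurableT iab).
congr (_ * fine _); apply: eq_integral => w _.
by rewrite !partial_ln_density.
Qed.

End scores.

(** * The reference prior of the sequential experiment *)

(** Factors are only known on an open set, so continuity has to be transported along
    an equality near the point. *)
Lemma near_eq_continuous (V U : topologicalType) (f g : V -> U) (y : V) :
  {near y, f =1 g} -> {for y, continuous f} -> {for y, continuous g}.
Proof.
move=> fg cf; rewrite /prop_for /continuous_at -(nbhs_singleton fg).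
exact: cvg_trans (near_eq_cvg fg) cf.
Qed.

Section separate_factors.
Context (R : realType) (m : nat) (q : 'I_m -> nat).
Local Notation dim := (\sum_(i < m) q i)%N.
Variable Theta : forall i : 'I_m, set 'rV[R]_(q i).
Arguments Theta : clear implicits.
Hypothesis Theta_open : forall i, open (Theta i).

Lemma open_product_set : open (product_set Theta).
Proof.
rewrite openE => theta Ttheta.
suff : \forall t \near theta, forall i, Theta i (submxrow t i) by [].
apply: (@filter_forall _ _ (fun i t => Theta i (submxrow t i)) (nbhs theta) _) => i.
have /nbhs_ballP[r /= r0 rT] : nbhs (submxrow theta i) (Theta i).
  by apply: open_nbhs_nbhs; split; [exact: Theta_open|exact: Ttheta].
apply/nbhs_ballP; exists r => //= t [_ tr]; apply: rT; split => // a c.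
by rewrite !mxE; exact: tr.
Qed.

Variable theta0 : 'rV[R]_dim.
Hypothesis theta0_in : product_set Theta theta0.

(** The embedding of the group [i] that freezes the other groups at [theta0]. *)
Definition lift_group (i : 'I_m) (y : 'rV[R]_(q i)) : 'rV[R]_dim :=
  splice (group_dim q i) [tuple y 0 c | c < q i] theta0.

Lemma submxrow_lift_group i y : submxrow (lift_group (i := i) y) i = y.
Proof.
rewrite /lift_group submxrow_splice_at; apply/rowP => c.
by rewrite mxE add0n (nth_map c) ?size_enum_ord// nth_ord_enum.
Qed.

Lemma submxrow_lift_group_neq i l y : l != i ->
  submxrow (lift_group (i := i) y) l = submxrow theta0 l.
Proof. exact: submxrow_splice_neq. Qed.

Lemma lift_group_in i y : Theta i y -> product_set Theta (lift_group y).
Proof.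
move=> Ty l; have [->|li] := eqVneq l i; first by rewrite submxrow_lift_group.
by rewrite submxrow_lift_group_neq//; exact: theta0_in.
Qed.

Lemma lift_group_continuous i : continuous (@lift_group i).
Proof.
move=> y A /nbhs_ballP[r /= r0 rA].
apply/nbhs_ballP; exists r => //= z [_ yz]; apply: rA; split => // a c.
rewrite !mxE; case: ifP => [/andP[ic ci]|_]; last exact: ballxx.
have ciq : (c - group_dim q i < q i)%N by rewrite ltn_subLR.
pose d := Ordinal ciq.
have E (v : 'rV[R]_(q i)) : nth 0 [tuple v 0 k | k < q i] (c - group_dim q i) = v 0 d.
  by rewrite (nth_map d) ?size_enum_ord// (nth_ord_enum d d).
by rewrite !E; exact: yz.
Qed.

(** Along the embedding of the group [i] the product [F] is a non-zero constant times
    [u i]. *)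
Lemma separate_continuous (F : 'rV[R]_dim -> R) (u : forall i : 'I_m, 'rV[R]_(q i) -> R) :
    {in product_set Theta, continuous F} ->
    (forall theta, product_set Theta theta -> F theta = \prod_i u i (submxrow theta i)) ->
    (forall i y, Theta i y -> u i y != 0) ->
  forall i, {in Theta i, continuous (u i)}.
Proof.
move=> cF FE u0 i y /set_mem Ty.
pose c := \prod_(l | l != i) u l (submxrow theta0 l).
have c0 : c != 0 by apply/prodf_neq0 => l _; apply: u0; exact: theta0_in.
have uE z : Theta i z -> u i z = F (lift_group z) / c.
  move=> Tz; rewrite FE; last exact: lift_group_in.
  rewrite (bigD1 i)//= submxrow_lift_group (eq_bigr (fun l => u l (submxrow theta0 l))).
    by rewrite mulfK.
  by move=> l li; rewrite submxrow_lift_group_neq.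
apply: (@near_eq_continuous _ _ (fun z => F (lift_group z) / c)).
  have nT : \forall z \near y, Theta i z.
    by apply: open_nbhs_nbhs; split; [exact: Theta_open|].
  by apply: filterS nT => z Tz; rewrite uE.
have cFl : {for y, continuous (F \o @lift_group i)}.
  apply: continuous_comp; first exact: lift_group_continuous.
  by apply: cF; apply/mem_set; exact: lift_group_in.
exact: cvgMr_tmp cFl.
Qed.

End separate_factors.

Theorem theorem2p1 (R : realType) (dX dW : measure_display)
  (X : measurableType dX) (W : measurableType dW)
  (m : nat) (q : 'I_m -> nat)
  (Theta : forall i : 'I_m, set 'rV[R]_(q i))
  (Theta_open : forall i, open (Theta i))
  (nu : {sigma_finite_measure set X -> \bar R})
  (f : 'rV[R]_(\sum_(i < m) q i) -> X -> R)
  (f_regular : regular_density (product_set Theta) nu f)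
  (P : 'rV[R]_(\sum_(i < m) q i) -> probability W R)
  (Xs : nat -> W -> X)
  (Xs_iid : iid_with_density (product_set Theta) P Xs nu f)
  (I_posdef : forall theta, product_set Theta theta ->
     positive_definite (single_information P f Xs theta))
  (I_continuous : {within product_set Theta,
     continuous (single_information P f Xs)})
  (N : W -> option nat)
  (N_stopping : is_stopping_time Xs N)
  (N_proper : proper_stopping_time (product_set Theta) P N)
  (EN_finite : forall theta, product_set Theta theta ->
     expected_stopping_time P N theta \is a fin_num)
  (EN_continuous : {within product_set Theta,
     continuous (fun theta => fine (expected_stopping_time P N theta))})
  (G : forall l i : 'I_m, 'rV[R]_(q i) -> 'M[R]_(q l))
  (I_block_diagonal : forall theta, product_set Theta theta ->
     single_information P f Xs theta =
       \mxdiag_(l < m) \prod_(i < m) G l i (submxrow theta i))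
  (g : forall i : 'I_m, 'rV[R]_(q i) -> R)
  (g_gt0 : forall i x, Theta i x -> 0 < g i x)
  (EN_product : forall theta, product_set Theta theta ->
     expected_stopping_time P N theta =
       (\prod_(i < m) g i (submxrow theta i))%:E)
  (K : forall i : 'I_m, nat -> set 'rV[R]_(q i))
  (K_exhaustion : forall i, compact_exhaustion (Theta i) (K i))
  (theta0 : 'rV[R]_(\sum_(i < m) q i))
  (theta0_in : product_set (fun i => K i 0%N) theta0) :
  is_reference_prior Theta K theta0 (single_information P f Xs)
    (fun theta => \prod_(i < m) Num.sqrt `|\det (G i i (submxrow theta i))|) /\
  forall prior : 'rV[R]_(\sum_(i < m) q i) -> R,
    is_reference_prior Theta K theta0 (single_information P f Xs) prior ->
    is_reference_prior Theta K theta0 (sequential_information P f Xs N)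
      (fun theta =>
         (\prod_(i < m) g i (submxrow theta i) `^ ((q i)%:R / 2)) * prior theta).
Proof.
have Theta_prod_open := open_product_set Theta_open.
have theta0_Theta : product_set Theta theta0.
  by move=> i; have [/(_ 0%N)[_ KT] _ _ _] := K_exhaustion i; apply: KT; exact: theta0_in.
pose B theta (l : 'I_m) : 'M[R]_(q l) := \prod_(i < m) G l i (submxrow theta i).
have uB theta : product_set Theta theta -> forall l, B theta l \in unitmx.
  move=> Ttheta; apply: unitmx_mxdiag_block; rewrite -I_block_diagonal//.
  exact/positive_definite_unit/I_posdef.
pose a j i y : R := `|\det (G j i y)|.
have detB theta j : `|\det (B theta j)| = \prod_i a j i (submxrow theta i).
  by rewrite /B det_prod normr_prod.
have a_neq0 j i y : Theta i y -> a j i y != 0.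
  move=> Ty; have := uB _ (lift_group_in theta0_Theta Ty) j.
  rewrite unitmxE unitfE -normr_eq0 detB => /prodf_neq0/(_ i isT).
  by rewrite submxrow_lift_group.
have a_gt0 j i y : Theta i y -> 0 < a j i y.
  by move=> Ty; rewrite lt0r a_neq0//= normr_ge0.
have a_continuous j : forall i, {in Theta i, continuous (a j i)}.
  apply: (@separate_continuous _ _ _ _ Theta_open _ theta0_Theta
    (fun theta => `|\det (submxblock (single_information P f Xs theta) j j)|)).
  - rewrite continuous_open_subspace// in I_continuous.
    move=> theta /I_continuous cI; apply: (@continuous_comp _ _ _
      (single_information P f Xs) (fun M => `|\det (submxblock M j j)|)) => //.
    exact: abs_det_submxblock_continuous.
  - move=> theta Ttheta; rewrite I_block_diagonal// submxblock_diag; exact: detB.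
  - exact: a_neq0.
have single_det theta : product_set Theta theta -> forall j,
    `|\det (h_block (single_information P f Xs theta) j)| =
    \prod_i a j i (submxrow theta i).
  move=> Ttheta j; rewrite I_block_diagonal// h_block_mxdiag; last exact: uB.
  exact: detB.
split.
  exact: (is_reference_prior_sqrt_factor Theta_open a_gt0 a_continuous single_det
    K_exhaustion theta0_in).
move=> prior prior_ref.
have [c c0 priorE] := reference_prior_unique Theta_open a_gt0 a_continuous
  single_det K_exhaustion theta0_in prior_ref.
pose EN theta := \prod_(i < m) g i (submxrow theta i).
have EN_gt0 theta : product_set Theta theta -> 0 < EN theta.
  by move=> Tt; apply: prodr_gt0 => i _; exact: g_gt0.
have g_continuous : forall i, {in Theta i, continuous (g i)}.
  apply: (@separate_continuous _ _ _ _ Theta_open _ theta0_Theta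
    (fun theta => fine (expected_stopping_time P N theta))).
  - by rewrite continuous_open_subspace// in EN_continuous.
  - by move=> theta Tt; rewrite EN_product.
  - by move=> i y Ty; rewrite gt_eqF// g_gt0.
(* Block [j] has order [q j], whence the exponent of [E(N)] in its determinant. *)
pose a' j i y := g i y ^+ q j * a j i y.
have a'_gt0 j i y : Theta i y -> 0 < a' j i y.
  by move=> Ty; rewrite mulr_gt0 ?exprn_gt0 ?g_gt0 ?a_gt0.
have a'_continuous j i : {in Theta i, continuous (a' j i)}.
  move=> y Ty; apply: (@continuousM _ _ (fun y => g i y ^+ q j) (a j i)).
    apply: (@continuous_comp _ _ _ (g i) (fun z => z ^+ q j)).
      exact: g_continuous.
    exact: exprn_continuous.
  exact: a_continuous.
have sequential_det theta : product_set Theta theta -> forall j,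
    `|\det (h_block (sequential_information P f Xs N theta) j)| =
    \prod_i a' j i (submxrow theta i).
  move=> Tt j.
  rewrite (sequential_informationE Theta_prod_open f_regular Xs_iid Tt N_stopping
    (N_proper _ Tt) (EN_product _ Tt)).
  rewrite I_block_diagonal// scale_mxdiag h_block_mxdiag; last first.
    move=> l; rewrite unitmxZ ?unitfE; first exact: uB.
    by rewrite gt_eqF// EN_gt0.
  rewrite detZ normrM detB ger0_norm ?exprn_ge0 ?ltW ?EN_gt0//.
  by rewrite -prodrXl -big_split.
have [c' c'0 ref'] := is_reference_prior_sqrt_factor Theta_open a'_gt0 a'_continuous
  sequential_det K_exhaustion theta0_in.
exists (c' / c); first exact: divr_gt0.
move=> theta Tt; have := ref' theta Tt; congr (_ --> _).
rewrite priorE// [X in _ = _ * X]mulrCA [RHS]mulrA mulfVK ?gt_eqF//; congr (_ * _).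
rewrite -big_split; apply: eq_bigr => i _; rewrite /sqrt_factor /=.
rewrite sqrtrM; last by rewrite exprn_ge0// ltW// g_gt0.
have g0 : 0 <= g i (submxrow theta i) by rewrite ltW// g_gt0.
by rewrite powRrM powR_mulrn// powR12_sqrt// exprn_ge0.
Qed.
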